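(* Let $K$ be a field, let $n,d\ge2$ with $d\ne3$, let $\mathbf a=(0,\dots,0,1,d-1)$, $\Gamma=V(n,d)\setminus\{\mathbf a\}$, $S=K[x_\alpha:\alpha\in\Gamma]$ and let $I(\Gamma)$ be the kernel of $S\to K[\Gamma]$, $x_\alpha\mapsto t^\alpha$. Let $\prec$ be the graded reverse lexicographic order on $S$ with respect to the ordering of variables $x_\alpha>x_\beta$ iff $\alpha<\beta$ lexicographically. For each pair $\alpha\le\beta$ in $\Gamma$ such that the chain $(\alpha,\beta)$ is not minimal, let $(\gamma,\delta)$ be the minimal chain with $\gamma+\delta=\alpha+\beta$. Then the set $\mathcal G$ of all such binomials $x_\alpha x_\beta-x_\gamma x_\delta$ is a Gröbner basis of $I(\Gamma)$ with respect to $\prec$. Consequently $K[\Gamma]$ is Koszul.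
   Context: $V(n,d)=\{\mathbf b\in\mathbb N^n:\sum_i b_i=d\}$, ordered lexicographically: $b<c$ iff the first nonzero coordinate of $c-b$ is positive. $K[\Gamma]$ is the $K$-subalgebra of $K[t_1,\dots,t_n]$ generated by $t^\alpha$, $\alpha\in\Gamma$, standard graded. A chain of length $k$ is a tuple $(u^1,\dots,u^k)\in V(n,d)^k$; its $\mathbf a$-degree is the number of $j$ with $u^j=\mathbf a$. Chains of length $k$ with equal sum are compared by $\mathbf a$-degree first (smaller is smaller), then lexicographically as tuples (comparing first entries first, using the order on $V(n,d)$). A chain is minimal if it is smallest among all chains in $V(n,d)^k$ with the same sum. (The minimal chain $(\gamma,\delta)$ above has $\mathbf a$-degree $0$, so $\gamma,\delta\in\Gamma$.) Koszul means the residue field $K$ has a linear free resolution over $K[\Gamma]$. *)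

(* Defs.v *)
From HB Require Import structures.
From mathcomp Require Import all_boot all_order all_algebra.
From mathcomp Require Import mpoly.
Set Implicit Arguments. Unset Strict Implicit. Unset Printing Implicit Defensive.
Import GRing.Theory.
Local Open Scope ring_scope.

Definition lexlt n (b c : 'X_{1..n}) : bool :=
  [exists i : 'I_n, (b i < c i)%N &&
     [forall j : 'I_n, (j < i)%N ==> (b j == c j)]].
Definition lexle n (b c : 'X_{1..n}) : bool := (b == c) || lexlt b c.

Definition inV (n d : nat) (b : 'X_{1..n}) : bool := mdeg b == d.

Definition avec (n d : nat) : 'X_{1..n} :=
  [multinom (if (i : nat) == n.-2 then 1 else if (i : nat) == n.-1 then d.-1 else 0)%N
   | i < n].

Definition adeg (n d : nat) (u : 'X_{1..n} * 'X_{1..n}) : nat :=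
  ((u.1 == avec n d) + (u.2 == avec n d))%N.

Definition chain_lt (n d : nat) (u w : 'X_{1..n} * 'X_{1..n}) : bool :=
  (adeg d u < adeg d w)%N ||
  ((adeg d u == adeg d w) &&
   (lexlt u.1 w.1 || ((u.1 == w.1) && lexlt u.2 w.2))).

Definition minimal_chain (n d : nat) (u : 'X_{1..n} * 'X_{1..n}) : Prop :=
  [/\ inV d u.1, inV d u.2 &
    forall w : 'X_{1..n} * 'X_{1..n}, inV d w.1 -> inV d w.2 ->
      (w.1 + w.2 = u.1 + u.2)%MM -> u = w \/ chain_lt d u w].

Definition Gam (n d : nat) : seq 'X_{1..n} :=
  [seq val x | x <- enum {: 'X_{1..n < d.+1}} &
     inV d (val x) && (val x != avec n d)].

Definition gsz (n d : nat) : nat := size (Gam n d).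

(* the variable x_i of S (i : 'I_(gsz n d)) corresponds to alpha = galpha i *)
Definition galpha (n d : nat) (i : 'I_(gsz n d)) : 'X_{1..n} := nth 0%MM (Gam n d) i.

Definition phiG (K : fieldType) (n d : nat) (F : {mpoly K[gsz n d]}) : {mpoly K[n]} :=
  F \mPo [tuple 'X_[galpha i] | i < gsz n d].

Definition inIG (K : fieldType) (n d : nat) (F : {mpoly K[gsz n d]}) : Prop := phiG F = 0.

(* graded reverse lexicographic order on monomials of S, for the variable
   ordering x_alpha > x_beta iff alpha <lex beta.
   grevlex_lt u v  means  u < v. *)
Definition grevlex_lt (n d : nat) (u v : 'X_{1..gsz n d}) : bool :=
  (mdeg u < mdeg v)%N ||
  ((mdeg u == mdeg v) &&
   [exists i : 'I_(gsz n d), (v i < u i)%N &&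
      [forall j : 'I_(gsz n d), lexlt (galpha i) (galpha j) ==> (u j == v j)]]).

Definition is_lead_mon (K : fieldType) m (lt : rel 'X_{1..m}) (F : {mpoly K[m]})
  (u : 'X_{1..m}) : Prop :=
  u \in msupp F /\ forall v, v \in msupp F -> v != u -> lt v u.

Definition groebner_basis (K : fieldType) m (lt : rel 'X_{1..m})
  (I G : {mpoly K[m]} -> Prop) : Prop :=
  (forall g, G g -> I g) /\
  forall f, I f -> f != 0 ->
    exists g, [/\ G g, g != 0 &
      exists u v, [/\ is_lead_mon lt f u, is_lead_mon lt g v & (v <= u)%MM]].

Definition binomG (K : fieldType) (n d : nat) (F : {mpoly K[gsz n d]}) : Prop :=
  exists i j k l : 'I_(gsz n d),
    [/\ lexle (galpha i) (galpha j),
        ~ minimal_chain d (galpha i, galpha j),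
        minimal_chain d (galpha k, galpha l),
        (galpha k + galpha l = galpha i + galpha j)%MM &
        F = 'X_i * 'X_j - 'X_k * 'X_l].

Definition inKG (K : fieldType) (n d : nat) (p : {mpoly K[n]}) : Prop :=
  exists F : {mpoly K[gsz n d]}, phiG F = p.

Definition linKG (K : fieldType) (n d : nat) (p : {mpoly K[n]}) : Prop :=
  exists F : {mpoly K[gsz n d]}, all (fun u => mdeg u == 1%N) (msupp F) /\ phiG F = p.

Definition rowKG (K : fieldType) (n d : nat) q (v : 'rV[{mpoly K[n]}]_q) : Prop :=
  forall c, inKG d (v ord0 c).

Definition exactKG (K : fieldType) (n d : nat) p q r
  (A : 'M[{mpoly K[n]}]_(p, q)) (B : 'M[{mpoly K[n]}]_(q, r)) : Prop :=
  forall v : 'rV_q, rowKG d v ->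
    (v *m B = 0 <-> exists w : 'rV_p, rowKG d w /\ v = w *m A).

(* K has a linear free resolution over K[Gamma]:
     ... -> R^(b 2) --M 1--> R^(b 1) --M 0--> R^(b 0) --M0--> R --> K --> 0
   with all matrix entries linear forms of K[Gamma] (R(-i)^(b_i) in
   homological degree i), exact everywhere; the augmentation R -> K is
   the quotient by the homogeneous maximal ideal (zero constant term). *)
Definition koszulKG (K : fieldType) (n d : nat) : Prop :=
  exists (b : nat -> nat) (M0 : 'M[{mpoly K[n]}]_(b 0%N, 1))
         (M : forall i, 'M[{mpoly K[n]}]_(b i.+1, b i)),
    [/\ forall r c, linKG d (M0 r c),
        forall i r c, linKG d (M i r c),
        forall f : {mpoly K[n]}, inKG d f ->
          (f@_0%MM = 0 <-> exists w : 'rV_(b 0%N), rowKG d w /\ f = (w *m M0) ord0 ord0),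
        exactKG d (M 0%N) M0 &
        forall i, exactKG d (M i.+1) (M i)].

(* Main.v *)
(* Write M and N for the last two letters and a = M N^(d-1).  If (x, y) is minimal
   and x contains a letter i, y a letter j > i, then exchanging i and j would
   produce a smaller chain unless it creates a; hence either every letter of y
   precedes every letter of x, or x is one of the two exceptional words M^2 N^(d-2)
   and i N^(d-1).  This classification shows that minimality is transitive (here
   d <> 3 enters) and that a chain whose adjacent pairs are minimal is determined by
   its sum, so these normal words index a K-basis of K[Gamma].  The Groebner basis
   statement follows, because the grevlex-smallest monomial of each fibre is normal.
   For Koszulness, Anick's resolution is built: the free module in degree i has as
   basis the words of length i all of whose adjacent pairs are not minimal, a basis
   element of multidegree lam is identified with a word by concatenating the normal
   word of its coefficient, and the differential is the identity on words up to
   lexicographically smaller ones. *)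
From Stdlib Require Import ClassicalEpsilon.
Require Import Defs.
From mathcomp Require Import all_boot all_order all_algebra.
From mathcomp Require Import mpoly zify.
Set Implicit Arguments. Unset Strict Implicit. Unset Printing Implicit Defensive.
Import Order.TTheory GRing.Theory.

(** * The lexicographic order and minimal pairs *)

Section LexOrder.
Variables n d : nat.
Implicit Types x y b c : 'X_{1..n}.

Lemma lexltP b c : reflect
  (exists2 i : 'I_n, forall j : 'I_n, j < i -> b j = c j & b i < c i) (lexlt b c).
Proof.
apply: (iffP existsP) => [[i /andP[lti /forallP h]]|[i h lti]]; exists i => //.
  by move=> j ltj; apply/eqP/(implyP (h j)).
by rewrite lti; apply/forallP => j; apply/implyP => /h /eqP.
Qed.

Lemma lexlt_ltmc b c : mdeg b = mdeg c -> lexlt b c = (b < c)%O.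
Proof. by move=> e; apply/lexltP/(ltmcP e). Qed.

Lemma lexle_lemc b c : mdeg b = mdeg c -> lexle b c = (b <= c)%O.
Proof. by move=> e; rewrite /lexle lexlt_ltmc // le_eqVlt. Qed.

Lemma lepm_mdeg_eq x y : (x <= y)%MM -> mdeg x = mdeg y -> x = y.
Proof.
move=> /submK <-; rewrite mdegD => /eqP; rewrite eq_sym.
rewrite -[X in _ == X]add0n eqn_add2r mdeg_eq0 => /eqP ->.
by rewrite add0m.
Qed.

Lemma mdeg_coord_le x (k : 'I_n) : x k <= mdeg x.
Proof. by rewrite mdegE (bigD1 k) //= leq_addr. Qed.

Lemma mdeg_coord2_le x (k l : 'I_n) : k != l -> x k + x l <= mdeg x.
Proof.
by move=> kl; rewrite mdegE (bigD1 k) //= (bigD1 l) 1?eq_sym //= addnA leq_addr.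
Qed.

Lemma mnm_single x (k : 'I_n) : (forall j, j != k -> x j = 0) -> x k = mdeg x.
Proof. by move=> h; rewrite mdegE (bigD1 k) //= big1 ?addn0. Qed.

Lemma mnm_coord_full x (k : 'I_n) : x k = mdeg x -> x = (U_(k) *+ mdeg x)%MM.
Proof.
move=> e; apply/mnmP => j; rewrite mulmnE mnm1E.
case: eqVneq => [<-|kj]; first by rewrite mul1n.
by have := mdeg_coord2_le x kj; lia.
Qed.

Lemma mnm_gt0 x : 0 < mdeg x -> exists k, 0 < x k.
Proof.
rewrite mdegE lt0n => /eqP h; case: (pickP (fun k => 0 < x k)) => [k ?|h']; first by exists k.
by case: h; rewrite big1 // => k _; have := h' k; lia.
Qed.

Definition Gset : {pred 'X_{1..n}} := [pred x | inV d x && (x != avec n d)].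

Lemma mem_Gam x : (x \in Gam n d) = (x \in Gset).
Proof.
rewrite inE; apply/mapP/idP => [[w]|/andP[dx ax]].
  by rewrite mem_filter => /andP[h _] ->.
have lt_d : mdeg x < d.+1 by rewrite (eqP dx).
by exists (BMultinom lt_d); rewrite // mem_filter /= dx ax mem_enum.
Qed.

Lemma Gset_mdeg x : x \in Gset -> mdeg x = d.
Proof. by case/andP => /eqP. Qed.

Lemma Gset_neq x : x \in Gset -> x != avec n d.
Proof. by case/andP. Qed.

Lemma adeg_Gset x y : x \in Gset -> y \in Gset -> adeg d (x, y) = 0.
Proof. by move=> /Gset_neq/negPf hx /Gset_neq/negPf hy; rewrite /adeg /= hx hy. Qed.

(** Chains in degree [d] live in a finite type of bounded monomials, which makes minimality
    decidable. *)
Definition minpair x y : bool :=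
  [&& inV d x, inV d y &
    [forall u : 'X_{1..n < d.+1}, forall v : 'X_{1..n < d.+1},
      [&& inV d u, inV d v & (u + v)%MM == (x + y)%MM] ==>
      (((x, y) == (val u, val v)) || chain_lt d (x, y) (val u, val v))]].

Lemma minpairP x y : reflect (minimal_chain d (x, y)) (minpair x y).
Proof.
apply: (iffP and3P) => [[dx dy /forallP h]|[dx dy h]]; split => //.
  case=> u v /= du dv e.
  have lu : mdeg u < d.+1 by rewrite (eqP du).
  have lv : mdeg v < d.+1 by rewrite (eqP dv).
  have /forallP/(_ (BMultinom lv))/implyP := h (BMultinom lu).
  by rewrite /= du dv e eqxx => /(_ isT) /orP[/eqP|]; [left|right].
apply/forallP => u; apply/forallP => v; apply/implyP => /and3P[du dv /eqP e].
by case: (h (val u, val v) du dv e) => [->|->]; rewrite ?eqxx ?orbT.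
Qed.

(* A sum-preserving exchange that lowers the first entry must create the
   deleted vector. *)
Lemma minpair_exchange x y x' y' : x \in Gset -> y \in Gset -> minpair x y ->
  inV d x' -> inV d y' -> (x' + y' = x + y)%MM -> lexlt x' x ->
  x' = avec n d \/ y' = avec n d.
Proof.
move=> Gx Gy /minpairP[_ _ /(_ (x', y'))] /= h dx dy e lt.
have [->|nx] := eqVneq x' (avec n d); first by left.
have [->|ny] := eqVneq y' (avec n d); first by right.
have Gx' : x' \in Gset by rewrite inE dx nx.
have Gy' : y' \in Gset by rewrite inE dy ny.
move: lt; rewrite lexlt_ltmc ?Gset_mdeg // => lt.
case: (h dx dy e) => [[ex _]|]; first by rewrite ex ltxx in lt.
rewrite /chain_lt !adeg_Gset //= !lexlt_ltmc ?Gset_mdeg //.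
by rewrite ltNge (ltW lt) eq_sym (lt_eqF lt).
Qed.

Lemma minpair_le x y : x \in Gset -> y \in Gset -> minpair x y -> (x <= y)%O.
Proof.
move=> Gx Gy m; rewrite leNgt; apply/negP => lt.
have [] := @minpair_exchange x y y x Gx Gy m; rewrite ?(addmC y) //.
- by case/andP: Gy.
- by case/andP: Gx.
- by rewrite lexlt_ltmc ?Gset_mdeg.
- by move/eqP; rewrite (negPf (Gset_neq Gy)).
- by move/eqP; rewrite (negPf (Gset_neq Gx)).
Qed.

Definition separated y x := forall i j : 'I_n, 0 < x i -> 0 < y j -> j <= i.

(** Here x consists of the last d letters of the product. If u < x first differs from x at i, then i
    occurs in x, so no letter after i occurs in y; hence u <= x coordinatewise, and equal degrees
    force u = x. *)
Lemma separated_minpair x y :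
  x \in Gset -> y \in Gset -> separated y x -> minpair x y.
Proof.
move=> Gx Gy sep; have [dx dy] := (Gset_mdeg Gx, Gset_mdeg Gy).
apply/minpairP; split => [||[u v] /= /eqP du /eqP dv e]; rewrite ?/inV ?dx ?dy //=.
have [eux|nux] := eqVneq u x.
  left; rewrite eux; congr pair; apply/mnmP => i.
  by move/mnmP/(_ i): e; rewrite eux !mnmDE; lia.
right; rewrite /chain_lt adeg_Gset //=; case: (posnP (adeg d (u, v))) => // ->.
rewrite lexlt_ltmc ?dx //= ltNge le_eqVlt (negPf nux) /=.
case: ltmcP => //=; rewrite ?dx // => -[i eqi lti]; case/eqP: nux.
apply: lepm_mdeg_eq; last by rewrite dx.
apply/mnm_lepP => k; move/mnmP/(_ k): e; rewrite !mnmDE => e.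
case: (ltngtP k i) => [/eqi ->//|ltik|/val_inj ->]; last exact: ltnW.
have : y k = 0 by apply/eqP; rewrite -leqn0 leqNgt; apply/negP => /(sep i k); lia.
lia.
Qed.

(** Separation makes y the word of the first [mdeg y] letters of the sum. *)
Lemma separated_uniq y y' r r' : separated y r -> separated y' r' ->
  mdeg y = mdeg y' -> (y + r = y' + r')%MM -> y = y'.
Proof.
wlog le : y y' r r' / (y <= y')%O => [hw s s' e e'|s _ e e'].
  by case: (leP y y') => [|/ltW] le; [|apply/esym]; apply: hw le _ _ _ _; eauto.
move: le; rewrite le_eqVlt => /predU1P[//|/(ltmcP e)[i eqi lti]].
apply: lepm_mdeg_eq => //; apply/mnm_lepP => k.
have ri : 0 < r i by move/mnmP/(_ i): e'; rewrite !mnmDE; lia.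
case: (ltngtP k i) => [/eqi ->//|ltik|/val_inj ->]; last exact: ltnW.
case: (posnP (y k)) => [->//|yk]; have := s i k ri yk; lia.
Qed.

End LexOrder.

(** * Sums of words and normal words *)

Section WordSums.
Variables n d : nat.
Implicit Types (x y : 'X_{1..n}) (s t : seq 'X_{1..n}).

Definition wsum s : 'X_{1..n} := (\sum_(x <- s) x)%MM.

Lemma wsum_nil : wsum [::] = 0%MM.
Proof. exact: big_nil. Qed.

Lemma wsum_cons x s : wsum (x :: s) = (x + wsum s)%MM.
Proof. exact: big_cons. Qed.

Lemma wsum_cat s t : wsum (s ++ t) = (wsum s + wsum t)%MM.
Proof. exact: big_cat. Qed.

Lemma wsum_rcons s x : wsum (rcons s x) = (wsum s + x)%MM.
Proof. by rewrite -cats1 wsum_cat wsum_cons wsum_nil addm0. Qed.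

Lemma perm_wsum s t : perm_eq s t -> wsum s = wsum t.
Proof. exact: perm_big. Qed.

Lemma wsum_rem x s : x \in s -> wsum s = (x + wsum (rem x s))%MM.
Proof. by move=> xs; rewrite (perm_wsum (perm_to_rem xs)) wsum_cons. Qed.

Lemma wsum_coord_le x s (k : 'I_n) : x \in s -> x k <= wsum s k.
Proof. by move=> /wsum_rem ->; rewrite mnmDE leq_addr. Qed.

Lemma wsum_coord_filter s (k : 'I_n) :
  wsum s k = wsum [seq x : 'X_{1..n} <- s | 0 < x k] k.
Proof.
elim: s => //= x s ih; rewrite wsum_cons mnmDE ih.
by case: posnP => [->|_]; rewrite ?wsum_cons ?mnmDE.
Qed.

Lemma mdeg_wsum s : all (mem (@Gset n d)) s -> mdeg (wsum s) = size s * d.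
Proof.
elim: s => [|x s ih /=]; first by rewrite wsum_nil mdeg0.
by case/andP => Gx /ih h; rewrite wsum_cons mdegD h (Gset_mdeg Gx) mulSn.
Qed.

Definition normal s := all (mem (@Gset n d)) s && sorted (@minpair n d) s.

End WordSums.

(** * Classification of minimal pairs and uniqueness of normal words *)

Section MinimalPairs.
Variables (n d : nat) (oM oN : 'I_n).
Hypotheses (n_gt1 : 1 < n) (d_gt1 : 1 < d) (oME : val oM = n.-2) (oNE : val oN = n.-1).
Implicit Types (x y p q : 'X_{1..n}) (s t : seq 'X_{1..n}).
Local Notation Gset := (@Gset n d).
Local Notation minpair := (@minpair n d).
Local Notation normal := (@normal n d).

Lemma ord_le_oN (k : 'I_n) : k <= oN.
Proof. by rewrite oNE; have := ltn_ord k; lia. Qed.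

Lemma oM_lt_oN : oM < oN.
Proof. rewrite oNE oME; lia. Qed.

Lemma ord_oM_oN (k : 'I_n) : k != oM -> k != oN -> k < oM.
Proof. by rewrite -!val_eqE /= oNE oME; have := ltn_ord k; lia. Qed.

Lemma oM_neq_oN : (oM == oN) = false.
Proof. by have := oM_lt_oN; rewrite -val_eqE /=; lia. Qed.

Lemma avecE (k : 'I_n) : avec n d k = (k == oM) + (k == oN) * d.-1.
Proof.
rewrite mnmE -!val_eqE /= oME oNE.
by case: eqP => [->|_]; case: eqP => //= h; rewrite ?mul1n ?mul0n //; lia.
Qed.

(** Exchanging the subword p of x with the subword q of y lowers the first entry, so one of the two
    results is a. The subtracted words are moved across the equations to avoid truncated
    subtraction. *)
Lemma minpair_swap x y p q : x \in Gset -> y \in Gset -> minpair x y ->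
  (p <= x)%MM -> (q <= y)%MM -> mdeg p = mdeg q -> lexlt q p ->
  (x + q = avec n d + p)%MM \/ (y + p = avec n d + q)%MM.
Proof.
move=> Gx Gy m px qy e /lexltP[i eqi lti].
have [dx dy] := (Gset_mdeg Gx, Gset_mdeg Gy).
have [] := @minpair_exchange n d x y (x - p + q)%MM (y - q + p)%MM Gx Gy m.
- by rewrite /inV mdegD -e -mdegD submK // dx.
- by rewrite /inV mdegD e -mdegD submK // dy.
- apply/mnmP => k; rewrite !mnmE.
  by move/mnm_lepP/(_ k): px; move/mnm_lepP/(_ k): qy; lia.
- apply/lexltP; exists i => [j /eqi|]; rewrite !mnmE.
    by move/mnm_lepP/(_ j): px; lia.
  by move/mnm_lepP/(_ i): px; lia.
- by move=> <-; left; rewrite -addmA [(q + p)%MM]addmC addmA submK.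
- by move=> <-; right; rewrite -addmA [(p + q)%MM]addmC addmA submK.
Qed.

Lemma le_no_oM x y : x \in Gset -> y \in Gset -> (x <= y)%O ->
  (forall k, k != oN -> y k = 0) -> forall k, k != oN -> x k = 0.
Proof.
move=> Gx Gy; rewrite le_eqVlt => /predU1P[->//|].
case/ltmcP => [|i eqi lti y0 k kN]; first by rewrite (Gset_mdeg Gx) (Gset_mdeg Gy).
have iN : i = oN by apply/eqP/negPn/negP => /y0 h; rewrite h in lti.
by rewrite eqi ?y0 // iN ltn_neqAle ord_le_oN andbT.
Qed.

(** If instead y became a, then i = M, j = N and y = N^d. This is the lexicographically least word,
    so x <= y would leave no M in x. *)
Lemma minpair_swap1 x y (i j : 'I_n) : x \in Gset -> y \in Gset -> minpair x y ->
  i < j -> 0 < x i -> 0 < y j -> (x + U_(j) = avec n d + U_(i))%MM.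
Proof.
move=> Gx Gy m ltij xi yj.
have := @minpair_swap x y U_(i)%MM U_(j)%MM Gx Gy m.
case; rewrite ?mdeg1 ?lep1mP -?lt0n //.
  apply/lexltP; exists i => [k ltk|]; rewrite !mnm1E ?eqxx.
    by rewrite -!val_eqE /=; lia.
  by rewrite -val_eqE /=; lia.
move/mnmP => e; have jN := ord_le_oN j.
have iM : i = oM.
  apply/eqP/negPn/negP => iM; have := e i.
  rewrite !mnmDE !mnm1E avecE (negPf iM) eqxx -!val_eqE /=; lia.
have jN' : j = oN.
  apply/eqP; rewrite -val_eqE /=; move: ltij; rewrite iM oME oNE.
  by have := ltn_ord j; lia.
have y0 k : k != oN -> y k = 0.
  move=> kN; have := e k; rewrite !mnmDE !mnm1E avecE iM jN' (negPf kN).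
  by rewrite eq_sym (eq_sym oN) (negPf kN); lia.
have /(le_no_oM Gx Gy)/(_ y0 oM) := minpair_le Gx Gy m.
by rewrite oM_neq_oN => /(_ isT); rewrite -iM; lia.
Qed.

(** The exceptional word x = M^2 N^(d-2): exchanging one M of x with the N of y would create a. *)
Definition pair_t2 x y := [/\ x oM = 2, x oN = d - 2,
  forall k, k != oM -> k != oN -> x k = 0 & y oN = 1].

(** The exceptional word x = i N^(d-1): exchanging its i with the M of y would create a. *)
Definition pair_t3 x y := exists i : 'I_n, [/\ i < oM, x oN = d - 1,
  forall k, k != i -> k != oN -> x k = 0 &
  [/\ y oN = 0, y oM = 1 & forall k, k != oM -> 0 < y k -> k <= i]].

(** If separation fails at letters i < j, the exchange of i and j turns x into a, so x = a - j + i
    with j equal to M or N. For j = M this gives x = i N^(d-1), for j = N and i = M it gives M^2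
    N^(d-2). Further exchanges then restrict y. *)
Lemma minpair_cases x y : x \in Gset -> y \in Gset -> minpair x y ->
  [\/ separated y x, pair_t2 x y | pair_t3 x y].
Proof.
move=> Gx Gy m; have sw := minpair_swap1 Gx Gy m.
have [dx dy] := (Gset_mdeg Gx, Gset_mdeg Gy); have ltMN := oM_lt_oN.
have NM : (oN == oM) = false by rewrite eq_sym oM_neq_oN.
case: (boolP [forall i : 'I_n, forall j : 'I_n, (0 < x i) ==> (0 < y j) ==> (j <= i)]).
  move=> /forallP h; constructor 1 => i j xi yj.
  by move/forallP/(_ j): (h i); rewrite xi yj.
rewrite negb_forall => /existsP[i]; rewrite negb_forall => /existsP[j].
rewrite !negb_imply -ltnNge => /and3P[xi yj ltij].
have e := sw i j ltij xi yj; move/mnmP: (e) => e'.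
have iN : (i == oN) = false by have := ord_le_oN j; rewrite -val_eqE /=; lia.
case: (eqVneq j oN) => [jN|jN]; last first.
  have jM : j = oM.
    apply/eqP/negPn/negP => jM; have := e' j; rewrite !mnmDE !mnm1E avecE.
    by rewrite (negPf jM) (negPf jN) eqxx -val_eqE /=; lia.
  have ltiM : i < oM by rewrite -jM.
  have iM : (i == oM) = false by rewrite -val_eqE /=; lia.
  have xN : x oN = d - 1.
    have := e' oN; rewrite !mnmDE !mnm1E avecE jM oM_neq_oN iN NM eqxx; lia.
  have x0 k : k != i -> k != oN -> x k = 0.
    move=> ki kN; have := e' k; rewrite !mnmDE !mnm1E avecE jM (negPf kN).
    by rewrite (eq_sym i) (negPf ki) (eq_sym oM); case: (k == oM); lia.
  constructor 3; exists i; split => //; split.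
  - apply/eqP; rewrite -leqn0 leqNgt; apply/negP => yN.
    have := sw i oN _ xi yN; rewrite (ltn_trans ltiM) // => /(_ isT)/mnmP/(_ oN).
    by rewrite !mnmDE !mnm1E avecE xN iN NM eqxx; lia.
  - rewrite jM in yj; apply/eqP; rewrite eqn_leq yj andbT leqNgt; apply/negP => yM.
    (* With a second M in y, exchange i N and M^2: the new x has two letters M and the new y
       contains i, so neither is a. *)
    have := @minpair_swap x y (U_(i) + U_(oN))%MM (U_(oM) + U_(oM))%MM Gx Gy m.
    case.
    + apply/mnm_lepP => k; rewrite !mnmE; case: (eqVneq i k) => [<-|ik].
        by rewrite eq_sym iN addn0.
      by case: (eqVneq oN k) => [<-|//]; rewrite xN; lia.
    + apply/mnm_lepP => k; rewrite !mnmE; case: (eqVneq oM k) => [<-|//]; lia.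
    + by rewrite !mdegD !mdeg1.
    + apply/lexltP; exists i => [k ltk|]; rewrite !mnmE -!val_eqE /=; lia.
    + move/mnmP/(_ oM); rewrite !mnmDE !mnm1E !avecE -!val_eqE /=; lia.
    + move/mnmP/(_ i); rewrite !mnmDE !mnm1E !avecE -!val_eqE /=; lia.
  - move=> k kM yk; rewrite leqNgt; apply/negP => ltik.
    have := sw i k ltik xi yk; move/mnmP/(_ oM).
    rewrite !mnmDE !mnm1E !avecE eqxx iM (negPf kM) oM_neq_oN x0 ?oM_neq_oN //.
    by rewrite eq_sym iM.
subst j; case: (eqVneq i oM) => [iM|iM].
  subst i; have xM : x oM = 2.
    by have := e' oM; rewrite !mnmDE !mnm1E !avecE eqxx oM_neq_oN NM; lia.
  have xN : x oN = d - 2.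
    by have := e' oN; rewrite !mnmDE !mnm1E !avecE eqxx oM_neq_oN NM; lia.
  constructor 2; split => //.
    move=> k kM kN; have := e' k; rewrite !mnmDE !mnm1E !avecE.
    by rewrite !(eq_sym _ k) (negPf kM) (negPf kN); lia.
  apply/eqP; rewrite eqn_leq yj andbT leqNgt; apply/negP => yN.
  (* With a second N in y, exchange M^2 and N^2: the new x has no M and the new y has at least two,
     so neither is a. *)
  have := @minpair_swap x y (U_(oM) + U_(oM))%MM (U_(oN) + U_(oN))%MM Gx Gy m.
  case.
  + apply/mnm_lepP => k; rewrite !mnmE; case: (eqVneq oM k) => [<-|//]; lia.
  + apply/mnm_lepP => k; rewrite !mnmE; case: (eqVneq oN k) => [<-|//]; lia.
  + by rewrite !mdegD !mdeg1.
  + apply/lexltP; exists oM => [k ltk|]; rewrite !mnmE -!val_eqE /=; lia.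
  + move/mnmP/(_ oM); rewrite !mnmDE !mnm1E !avecE eqxx oM_neq_oN NM; lia.
  + move/mnmP/(_ oM); rewrite !mnmDE !mnm1E !avecE eqxx oM_neq_oN NM; lia.
(* Now x = i M N^(d-2) with i before M. Exchanging M with N keeps i in x, so it cannot produce a. *)
have xM : x oM = 1.
  by have := e' oM; rewrite !mnmDE !mnm1E !avecE eqxx oM_neq_oN NM (negPf iM); lia.
have /mnmP/(_ i) : (x + U_(oN) = avec n d + U_(oM))%MM by apply: sw; rewrite // xM.
by rewrite !mnmDE !mnm1E !avecE iN (negPf iM) !(eq_sym _ i) iN (negPf iM); lia.
Qed.

Hypothesis d_neq3 : d <> 3.

(** Of the nine combinations of types, three contradict the letter counts of y; in the others the
    letters of y separate x from z, except that x = y can occur when d = 2. *)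
Lemma minpair_trans y x z : x \in Gset -> y \in Gset -> z \in Gset ->
  minpair x y -> minpair y z -> minpair x z.
Proof.
move=> Gx Gy Gz mxy myz; have [[dx dy] dz] := (Gset_mdeg Gx, Gset_mdeg Gy, Gset_mdeg Gz).
have ltMN := oM_lt_oN.
case: (minpair_cases Gx Gy mxy) => [sxy|[xM xN x0 yN]|[i [liM xN x0 [yN yM yi]]]];
case: (minpair_cases Gy Gz myz) => [syz|[yM' yN' y0' zN']|[i' [liM' yN' y0' [zN' zM' zi']]]].
- apply: separated_minpair => // i k xi zk.
  by have [|j yj] := mnm_gt0 (x := y); [lia|apply: leq_trans (syz j k yj zk) (sxy i j xi yj)].
(* For d <> 2 the word y contains N, so x = N^d. For d = 2, y = M^2 and x uses only M and N; as x is
   not a = M N, it is N^2 or M^2 = y. *)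
- have [d2|d2] := eqVneq d 2; last first.
    apply: separated_minpair => // i k xi zk; apply: leq_trans (ord_le_oN k) (sxy _ _ xi _); lia.
  have x0 k : k != oM -> k != oN -> x k = 0.
    move=> kM kN; apply/eqP; rewrite -leqn0 leqNgt; apply/negP => xk.
    by have := sxy k oM xk; rewrite yM' => /(_ isT); have := ord_oM_oN kM kN; lia.
  have hMN : x oM + x oN = 2.
    rewrite -d2 -dx mdegE (bigD1 oM) //= (bigD1 oN) ?(eq_sym oN) ?oM_neq_oN //= big1 ?addn0 //.
    by move=> k /andP[]; exact: x0.
  have ha : x oM <> 1.
    move=> xM; case/eqP: (Gset_neq Gx); apply/mnmP => k; rewrite avecE.
    case: (eqVneq k oM) => [->|kM]; first by rewrite oM_neq_oN xM.
    by case: (eqVneq k oN) => [->|kN]; [lia|rewrite x0].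
  have [xM|xM] := eqVneq (x oM) 0.
    apply: separated_minpair => // k l xk _; suff -> : k = oN by exact: ord_le_oN.
    apply/eqP/negPn/negP => kN; case: (eqVneq k oM) xk => [->|kM]; first by rewrite xM.
    by rewrite x0.
  suff -> : x = y by [].
  apply/mnmP => k; case: (eqVneq k oM) => [->|kM]; first lia.
  by case: (eqVneq k oN) => [->|kN]; [lia|rewrite x0 // y0'].
- apply: separated_minpair => // i k xi zk; apply: leq_trans (ord_le_oN k) (sxy _ _ xi _); lia.
- have [|j] := mnm_gt0 (x := (y - U_(oN))%MM).
    have := dy; rewrite -[y in mdeg y](@submK _ U_(oN)%MM) ?mdegD ?mdeg1; first lia.
    by rewrite lep1mP; lia.
  rewrite mnmE mnm1E => yj; have jN : j != oN by apply/eqP => jN; rewrite jN eqxx in yj; lia.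
  apply: separated_minpair => // k l xk zl.
  have lj : l <= j by apply: syz zl; lia.
  have jM : j <= oM.
    by case: (eqVneq j oM) => [->//|jM]; have := ord_oM_oN jM jN; lia.
  have : oM <= k.
    case: (eqVneq k oM) => [->//|kM]; case: (eqVneq k oN) => [->|kN]; first lia.
    by rewrite x0 in xk.
  lia.
(* The word y has exactly one N and also d - 2 of them: this is where d <> 3 enters. *)
- lia.
- have d2 : d = 2 by lia.
  apply: separated_minpair => // k l xk zl.
  have kM : k = oM.
    apply/eqP/negPn/negP => kM; case: (eqVneq k oN) xk => [->|kN]; first lia.
    by rewrite x0.
  rewrite kM; case: (eqVneq l oM) => [->//|lM]; apply/ltnW/ord_oM_oN => //.
  by apply/eqP => lN; rewrite lN zN' in zl.
- have [|j] := mnm_gt0 (x := (y - U_(oM))%MM).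
    have := dy; rewrite -[y in mdeg y](@submK _ U_(oM)%MM) ?mdegD ?mdeg1; first lia.
    by rewrite lep1mP; lia.
  rewrite mnmE mnm1E => yj; have jM : j != oM by apply/eqP => jM; rewrite jM eqxx in yj; lia.
  apply: separated_minpair => // k l xk zl.
  have lj : l <= j by apply: syz zl; lia.
  have ji : j <= i by apply: yi => //; lia.
  suff : i <= k by lia.
  case: (eqVneq k i) => [->//|ki]; case: (eqVneq k oN) => [->|kN]; first lia.
  by rewrite x0 in xk.
- lia.
- lia.
Qed.

(** * Words with all pairs minimal, and their determination by the sum *)

Definition pairwise_minimal s := all (mem Gset) s && pairwise minpair s.

Lemma pairwise_minimal_subseq s t :
  subseq s t -> pairwise_minimal t -> pairwise_minimal s.
Proof.
move=> st /andP[/allP Gt pt]; rewrite /pairwise_minimal (subseq_pairwise st pt) andbT.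
by apply/allP => x /(mem_subseq st)/Gt.
Qed.

Lemma pairwise_minimal2 x y s : pairwise_minimal [:: x, y & s] ->
  [/\ x \in Gset, y \in Gset & minpair x y].
Proof. by case/andP => /= /and3P[-> -> _] /andP[/andP[->]]. Qed.

(* Two entries containing the last letter satisfy [pair_t2] unless
   the first is [d] times that letter; three of them would force [d = 3]. *)
Lemma last_power_mem s : pairwise_minimal s -> d <= wsum s oN ->
  (U_(oN) *+ d)%MM \in s.
Proof.
move=> ps; case: (boolP (_ \in s)) => // Nds; rewrite wsum_coord_filter leqNgt => /negP[].
have pfs := pairwise_minimal_subseq (filter_subseq (fun x : 'X_{1..n} => 0 < x oN) s) ps.
have cls x y : x \in s -> 0 < y oN -> x \in Gset -> y \in Gset -> minpair x y ->
    x oN = d - 2 /\ y oN = 1.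
  move=> xs yN Gx Gy m; case: (minpair_cases Gx Gy m) => [sep|[_ ? _ ?]//|[i [_ _ _ []]]]; last lia.
  case/negP: Nds; rewrite -(Gset_mdeg Gx) -mnm_coord_full //; apply: mnm_single.
  move=> j jN; apply/eqP; rewrite -leqn0 leqNgt; apply/negP => xj.
  by have := sep j oN xj yN; have := ord_le_oN j; move: jN; rewrite -val_eqE /=; lia.
have: {subset [seq x : 'X_{1..n} <- s | 0 < x oN] <= [pred x : 'X_{1..n} | (x \in s) && (0 < x oN)]}.
  by move=> x; rewrite mem_filter inE andbC.
case: [seq x : 'X_{1..n} <- s | 0 < x oN] pfs => [|u [|v [|w r]]] pf sub.
- by rewrite wsum_nil mnm0E; lia.
- rewrite wsum_cons wsum_nil addm0.
  have Gu : u \in Gset by case/andP: pf => /andP[].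
  rewrite ltn_neqAle -{2}(Gset_mdeg Gu) mdeg_coord_le andbT.
  apply/eqP => e; case/negP: Nds; rewrite -(Gset_mdeg Gu) -mnm_coord_full ?(Gset_mdeg Gu) //.
  by have /andP[] := sub u (mem_head _ _).
- have [Gu Gv m] := pairwise_minimal2 pf.
  have /andP[us _] := sub u (mem_head _ _).
  have /andP[_ vN] : v \in [pred x : 'X_{1..n} | (x \in s) && (0 < x oN)].
    by apply: sub; rewrite !inE eqxx orbT.
  by have [] := cls u v us vN Gu Gv m; rewrite !wsum_cons wsum_nil addm0 mnmDE; lia.
- have [Gu Gv m] := pairwise_minimal2 pf.
  have [_ Gw m'] : [/\ v \in Gset, w \in Gset & minpair v w].
    apply: (@pairwise_minimal2 _ _ r); apply: pairwise_minimal_subseq pf.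
    exact: subseq_cons.
  have /andP[us _] := sub u (mem_head _ _).
  have /andP[vs vN] : v \in [pred x : 'X_{1..n} | (x \in s) && (0 < x oN)].
    by apply: sub; rewrite !inE eqxx orbT.
  have /andP[_ wN] : w \in [pred x : 'X_{1..n} | (x \in s) && (0 < x oN)].
    by apply: sub; rewrite !inE eqxx !orbT.
  by have [_ ?] := cls u v us vN Gu Gv m; have [? _] := cls v w vs wN Gv Gw m'; lia.
Qed.

(** Without M^2, each entry has at most one M, so two entries u, v contain M. A separated pair
    forces u = M N = a, [pair_t2] forces u = M^2, and [pair_t3] leaves no M in u. *)
Lemma square_mem s : d = 2 -> pairwise_minimal s -> 1 < wsum s oM ->
  (U_(oM) *+ d)%MM \in s.
Proof.
move=> d2 ps; case: (boolP (_ \in s)) => // Mds; rewrite wsum_coord_filter ltnNge => /negP[].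
have pfs := pairwise_minimal_subseq (filter_subseq (fun x : 'X_{1..n} => 0 < x oM) s) ps.
have full x : x \in s -> x \in Gset -> x oM < 2.
  move=> xs Gx; have := mdeg_coord_le x oM; rewrite (Gset_mdeg Gx) {1}d2 => h.
  rewrite ltn_neqAle h andbT.
  apply/eqP => e; case/negP: Mds; rewrite -(Gset_mdeg Gx) -mnm_coord_full //.
  by rewrite (Gset_mdeg Gx) e d2.
have ltMN := oM_lt_oN.
have: {subset [seq x : 'X_{1..n} <- s | 0 < x oM] <= [pred x : 'X_{1..n} | (x \in s) && (0 < x oM)]}.
  by move=> x; rewrite mem_filter inE andbC.
case: [seq x : 'X_{1..n} <- s | 0 < x oM] pfs => [|u [|v r]] pf sub.
- by rewrite wsum_nil mnm0E.
- rewrite wsum_cons wsum_nil addm0.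
  have Gu : u \in Gset by case/andP: pf => /andP[].
  by have /andP[us _] := sub u (mem_head _ _); have := full u us Gu; lia.
- have [Gu Gv m] := pairwise_minimal2 pf.
  have /andP[us uM] := sub u (mem_head _ _).
  have /andP[_ vM] : v \in [pred x : 'X_{1..n} | (x \in s) && (0 < x oM)].
    by apply: sub; rewrite !inE eqxx orbT.
  have uM1 := full u us Gu.
  case: (minpair_cases Gu Gv m) => [sep|[]|[i [iM uN u0 _]]]; last 1 first.
  + have := u0 oM; rewrite oM_neq_oN -val_eqE /= => h.
    by suff : u oM = 0; [lia|apply: h => //; lia].
  + case/eqP: (Gset_neq Gu); apply/mnmP => k; rewrite avecE.
    have u0 j : j != oM -> j != oN -> u j = 0.
      move=> jM jN; apply/eqP; rewrite -leqn0 leqNgt; apply/negP => uj.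
      by have := sep j oM uj vM; have := ord_oM_oN jM jN; lia.
    have := Gset_mdeg Gu; rewrite mdegE (bigD1 oM) //= (bigD1 oN) /=; last first.
      by rewrite -val_eqE /=; lia.
    rewrite big1 ?addn0 => [e|j /andP[]]; last exact: u0.
    have uM' : u oM = 1 by lia.
    have uN : u oN = 1 by lia.
    case: (eqVneq k oM) => [->|kM]; first by rewrite oM_neq_oN uM'.
    by case: (eqVneq k oN) => [->|kN]; [rewrite uN d2|rewrite u0].
  + lia.
Qed.

(** If some (x, y) were exceptional, the bound on N would leave no N for another entry z. Minimality
    of (z, y) then contradicts the bounds, or gives z = M^d, which forms a minimal pair with x = i
    N^(d-1) in neither order. *)
Lemma last_separated s y : pairwise_minimal (rcons s y) -> 1 < size s ->
  wsum (rcons s y) oN < d -> (d = 2 -> wsum (rcons s y) oM <= 1) ->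
  separated y (wsum s).
Proof.
move=> /andP[]; rewrite all_rcons pairwise_rcons => /andP[Gy /allP Gs] /andP[/allP my ps].
move=> sz sN sM; suff h x : x \in s -> separated y x.
  elim: s h {Gs my ps sz sN sM} => [_ i j|x s ih h i j]; first by rewrite wsum_nil mnm0E.
  rewrite wsum_cons mnmDE addn_gt0 => /orP[xi|si]; first by apply: h xi; rewrite mem_head.
  by apply: ih si => z zs; apply: h; rewrite inE zs orbT.
move=> xs; have Gx := Gs x xs; have ltMN := oM_lt_oN.
(* The entry z sits at another position than x, though possibly with the same value, so its letters
   are counted separately in the sum. *)
have [z zs [mxz eqN eqM]] : exists2 z, z \in s & [/\ minpair x z \/ minpair z x,
    z oN + x oN + y oN < d & d = 2 -> z oM + x oM + y oM <= 1].
  case/splitPr: s / xs sz sN sM ps {my Gs} => p q.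
  rewrite !wsum_rcons wsum_cat wsum_cons pairwise_cat => sz sN sM.
  case/and3P => /allrelP pq _ /= /andP[/allP qx _].
  have [z zpq] : exists z, z \in p ++ q.
    case: p q sz {sN sM pq qx} => [|z p] [|w q] //=; first by exists w; rewrite mem_head.
      by exists z; rewrite mem_head.
    by exists z; rewrite mem_head.
  have zle k : z k <= (wsum p + wsum q)%MM k by rewrite -wsum_cat; apply: wsum_coord_le.
  exists z; first by move: zpq; rewrite !mem_cat inE => /orP[|] ->; rewrite ?orbT.
  split.
  - move: zpq; rewrite mem_cat => /orP[zp|zq]; [right|left]; last exact: qx.
    by apply: pq => //; rewrite mem_head.
  - by have := zle oN; move: sN; rewrite !mnmDE; lia.
  - by move/sM; have := zle oM; rewrite !mnmDE; lia.
have Gz := Gs z zs; have mxy := my x xs; have mzy := my z zs.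
clear ps sz sN sM my Gs xs zs.
case: (minpair_cases Gx Gy mxy) => [//|[xM xN x0 yN]|[i [iM xN x0 [yN yM _]]]].
  have [k zk] : exists k, 0 < z k by apply: mnm_gt0; rewrite (Gset_mdeg Gz); lia.
  case: (minpair_cases Gz Gy mzy) => [sep|[zM zN _ _]|[i [_ _ _ [? _ _]]]]; last lia.
    have kN : k = oN.
      by apply/val_inj/eqP; rewrite eqn_leq /= ord_le_oN sep // yN.
    by rewrite kN in zk; lia.
  by have := eqM; lia.
case: (minpair_cases Gz Gy mzy) => [sep|[_ _ _ ?]|[i' [_ ? _ _]]]; [|lia|lia].
have z0 k : k != oM -> z k = 0.
  move=> kM; apply/eqP; rewrite -leqn0 leqNgt; apply/negP => zk.
  case: (eqVneq k oN) => [kN|kN]; first by rewrite kN in zk; lia.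
  by have := sep k oM zk; rewrite yM => /(_ isT); have := ord_oM_oN kM kN; lia.
have zM : z oM = d by rewrite (mnm_single z0) (Gset_mdeg Gz).
have xi : 0 < x i.
  rewrite lt0n; apply/eqP => xi; have := Gset_mdeg Gx; rewrite -(@mnm_single _ x oN); first lia.
  by move=> j jN; case: (eqVneq j i) => [->//|ji]; apply: x0.
case: mxz => m.
  case: (minpair_cases Gx Gz m) => [sep'|[_ ? _ _]|[i' [_ _ _ [_ ? _]]]]; [|lia|lia].
  by have := sep' i oM xi; rewrite zM; lia.
case: (minpair_cases Gz Gx m) => [sep'|[? ? _ _]|[i' [_ ? _ _]]]; [|lia|lia].
by have := sep' oM oN; rewrite zM xN; lia.
Qed.

Lemma minpair_uniq x y x' y' : x \in Gset -> y \in Gset -> x' \in Gset -> y' \in Gset ->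
  minpair x y -> minpair x' y' -> (x + y = x' + y')%MM -> (x, y) = (x', y').
Proof.
move=> Gx Gy Gx' Gy' /minpairP[dx dy h] /minpairP[dx' dy' h'] e.
case: (h (x', y') dx' dy' (esym e)) => // l; case: (h' (x, y) dx dy e) => [->//|].
move: l; rewrite /chain_lt !adeg_Gset //= !lexlt_ltmc ?(Gset_mdeg Gx, Gset_mdeg Gy, Gset_mdeg Gx', Gset_mdeg Gy') //.
by case: (ltgtP x x') => //= _; case: (ltgtP y y').
Qed.

(** Induction on the length, cancelling a common entry: N^d if N occurs at least d times, M^2 if d =
    2 and M occurs at least twice, and otherwise the last entry, which consists of the first d
    letters of the sum. The common entry may sit at different positions, hence [perm_eq]. *)
Lemma pairwise_minimal_uniq s t : pairwise_minimal s -> pairwise_minimal t ->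
  wsum s = wsum t -> perm_eq s t.
Proof.
have [m] := ubnP (size s); elim: m s t => // m ih s t szm ps pt e.
have szt : size t = size s.
  case/andP: ps => Gs _; case/andP: pt => Gt _.
  by move/(congr1 mdeg): e; rewrite !(mdeg_wsum (d := d)) //; nia.
suff [sz2|[x xs xt]] : size s <= 2 \/ exists2 x, x \in s & x \in t.
- case: s t szt sz2 ps pt e {szm} => [|x [|y [|? ?]]] [|x' [|y' [|? ?]]] //= _ _.
    by rewrite !wsum_cons !wsum_nil !addm0 => _ _ ->.
  move=> /pairwise_minimal2[Gx Gy m1] /pairwise_minimal2[Gx' Gy' m2].
  rewrite !wsum_cons !wsum_nil !addm0 => e.
  by case: (minpair_uniq Gx Gy Gx' Gy' m1 m2 e) => -> ->.
- rewrite (permPl (perm_to_rem xs)) (permPr (perm_to_rem xt)) perm_cons; apply: ih.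
  + by rewrite size_rem //; case: s xs szm {ps e szt}.
  + exact: pairwise_minimal_subseq (rem_subseq _ _) ps.
  + exact: pairwise_minimal_subseq (rem_subseq _ _) pt.
  + by move: e; rewrite (wsum_rem xs) (wsum_rem xt) => /addmI.
case: (leqP (size s) 2) => sz2; [by left|right].
case: (leqP d (wsum s oN)) => sN.
  by exists (U_(oN) *+ d)%MM; apply: last_power_mem => //; rewrite -e.
case: (boolP ((d == 2) && (1 < wsum s oM))) => [/andP[/eqP d2 sM]|sM].
  by exists (U_(oM) *+ d)%MM; apply: square_mem => //; rewrite -e.
have {}sM : d = 2 -> wsum s oM <= 1 by move=> d2; move: sM; rewrite d2 /= -leqNgt.
case/lastP: s ps sz2 szt sN sM e {szm} => // s y ps; rewrite size_rcons => sz szt sN sM e.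
case/lastP: t pt szt e => // t z pt; rewrite size_rcons => -[szt] e.
exists y; first by rewrite mem_rcons mem_head.
suff -> : y = z by rewrite mem_rcons mem_head.
have := sN; have := sM; rewrite e => tM tN.
apply: (separated_uniq (last_separated ps _ sN sM) (last_separated pt _ tN tM)) => //.
- by rewrite szt.
- have [Gy Gz] : y \in Gset /\ z \in Gset.
    case/andP: ps; rewrite all_rcons => /andP[Gy _] _.
    by case/andP: pt; rewrite all_rcons => /andP[Gz _] _.
  by rewrite (Gset_mdeg Gy) (Gset_mdeg Gz).
- by rewrite addmC -wsum_rcons e wsum_rcons addmC.
Qed.

Lemma normal_pairwise s : normal s -> pairwise_minimal s.
Proof.
case/andP => Gs ss; rewrite /pairwise_minimal Gs /=.
rewrite -(@sorted_pairwise_in _ (mem Gset)) // => y x z Gy Gx Gz.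
exact: minpair_trans.
Qed.

Lemma normal_sorted s : normal s -> sorted <=%O s.
Proof.
case/andP => Gs; apply: (sub_in_sorted (P := mem Gset)) Gs => x y.
exact: minpair_le.
Qed.

(** Normal words are increasing, so being permutations of each other makes them equal. *)
Lemma normal_uniq s t : normal s -> normal t -> wsum s = wsum t -> s = t.
Proof.
move=> ns nt e; apply: le_sorted_eq; try exact: normal_sorted.
by apply: pairwise_minimal_uniq => //; apply: normal_pairwise.
Qed.

End MinimalPairs.

(** * Normal forms *)

Lemma seq_minimum (T : eqType) (le : rel T) (s : seq T) (x : T) :
  total le -> transitive le -> x \in s ->
  exists2 y, y \in s & forall z, z \in s -> le y z.
Proof.
move=> tot tr; have refl y : le y y by have := tot y y; rewrite orbb.
elim: s x => // x s ih _ _; case: s ih => [_|x' s /(_ x' (mem_head _ _)) [y ys h]].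
  by exists x; [rewrite mem_head|move=> z; rewrite inE => /eqP ->].
case/orP: (tot x y) => xy.
  exists x; first by rewrite mem_head.
  by move=> z; rewrite inE => /predU1P[->//|/h]; apply: tr.
exists y; first by rewrite inE ys orbT.
by move=> z; rewrite inE => /predU1P[->//|/h].
Qed.

Lemma not_sorted_split (T : Type) (e : rel T) (s : seq T) : ~~ sorted e s ->
  exists p x y q, s = p ++ [:: x, y & q] /\ ~~ e x y.
Proof.
elim: s => // x [|y s] ih //=; rewrite negb_and => /orP[exy|/ih].
  by exists [::], x, y, s.
by move=> [p [x' [y' [q [-> h]]]]]; exists (x :: p), x', y', q.
Qed.

Section Words.
Variables n d : nat.
Implicit Types (x y z : 'X_{1..n}) (s t u v w c : seq 'X_{1..n}).
Local Notation Gset := (@Gset n d).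
Local Notation minpair := (@minpair n d).
Local Notation normal := (@normal n d).
Local Notation Gword := (all (mem Gset)).
Local Notation g := (gsz n d).

Definition rho x := count (fun y => (y < x)%O) (Gam n d).

Lemma Gam_uniq : uniq (Gam n d).
Proof. by rewrite (map_inj_uniq val_inj) filter_uniq ?enum_uniq. Qed.

Lemma rho_lt x : x \in Gset -> rho x < g.
Proof.
rewrite -mem_Gam => Gx; rewrite ltn_neqAle count_size andbT -all_count.
by apply/allPn; exists x; rewrite ?ltxx.
Qed.

Lemma rho_mono x y : x \in Gset -> (x < y)%O -> rho x < rho y.
Proof.
rewrite -mem_Gam => Gx lt.
pose a := [pred z : 'X_{1..n} | (z < x)%O].
have := count_predUI a (pred1 x) (Gam n d).
rewrite (count_uniq_mem x Gam_uniq) Gx (@eq_count _ (predI _ _) pred0) ?count_pred0.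
  rewrite addn0 addn1 /rho -/a => <-; apply: sub_count => z /orP[]/=.
    by move=> /lt_trans; apply.
  by move/eqP->.
by move=> z /=; case: eqP => [->|_]; rewrite ?ltxx ?andbF.
Qed.

Lemma rho_inj x y : x \in Gset -> y \in Gset -> rho x = rho y -> x = y.
Proof.
by move=> Gx Gy e; case: (ltgtP x y) => // /rho_mono; rewrite ?Gx ?Gy e ltnn => /(_ isT).
Qed.

(* Reading a word as a base-[g] numeral turns the lexicographic order of words
   of equal length into the order of [nat]. *)
Fixpoint code s := if s is x :: s' then rho x * g ^ size s' + code s' else 0.

Lemma code_cat s t : code (s ++ t) = code s * g ^ size t + code t.
Proof.
by elim: s => //= x s ->; rewrite size_cat expnD mulnDl mulnA addnA.
Qed.

Lemma code_lt s : Gword s -> code s < g ^ size s.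
Proof.
elim: s => //= x s ih /andP[/rho_lt xg /ih h].
by rewrite expnS; apply: leq_trans (leq_mul xg (leqnn _)); rewrite mulSn; lia.
Qed.

Lemma leq_numeral a b r r' m : a <= b -> r <= r' -> a * m + r <= b * m + r'.
Proof. by move=> ab rr; rewrite leq_add // leq_mul. Qed.

Lemma ltn_numeral a b r r' m : r < m -> a < b -> a * m + r < b * m + r'.
Proof.
move=> rm ab; apply: leq_trans (leq_addr _ _).
by apply: leq_trans (leq_mul ab (leqnn _)); rewrite mulSn; lia.
Qed.

Lemma code_cat_le s s' t t' : size t = size t' -> code s <= code s' ->
  code t <= code t' -> code (s ++ t) <= code (s' ++ t').
Proof. by move=> e ? ?; rewrite !code_cat e; apply: leq_numeral. Qed.

Lemma code_cat_lt s s' t t' : Gword t -> size t = size t' -> code s < code s' ->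
  code (s ++ t) < code (s' ++ t').
Proof. by move=> /code_lt h e ?; rewrite !code_cat -e; apply: ltn_numeral. Qed.

Lemma code_inj s t : Gword s -> Gword t -> size s = size t ->
  code s = code t -> s = t.
Proof.
elim: s t => [|x s ih] [|y t] //= /andP[Gx Gs] /andP[Gy Gt] [e].
have [hs ht] := (code_lt Gs, code_lt Gt); rewrite e in hs *.
case: (ltngtP (rho x) (rho y)) => [lt|lt|exy] h.
- by have := ltn_numeral (code t) hs lt; rewrite h ltnn.
- by have := ltn_numeral (code s) ht lt; rewrite h ltnn.
- move: h; rewrite exy => /addnI h; rewrite (rho_inj Gx Gy exy); congr cons; exact: ih.
Qed.

(** Take the pair of least code with entries in Gamma; every chain that uses a has positive a-degree
    and is therefore larger. *)
Lemma exists_minpair x y : x \in Gset -> y \in Gset ->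
  exists x' y', [/\ x' \in Gset, y' \in Gset, minpair x' y' & (x' + y' = x + y)%MM].
Proof.
move=> Gx Gy.
pose L := [seq p <- [seq (a, b) | a <- Gam n d, b <- Gam n d] | (p.1 + p.2 == x + y)%MM].
have memL (u v : 'X_{1..n}) : ((u, v) \in L) = [&& (u + v == x + y)%MM, u \in Gset & v \in Gset].
  rewrite mem_filter; congr (_ && _); apply/allpairsP/andP.
    by case=> -[a b] /= []; rewrite !mem_Gam => ? ? [-> ->].
  by case=> Gu Gv; exists (u, v); rewrite !mem_Gam.
pose le := [rel p q : 'X_{1..n} * 'X_{1..n} | code [:: p.1; p.2] <= code [:: q.1; q.2]].
have [] := @seq_minimum _ le L (x, y); rewrite ?memL ?eqxx ?Gx ?Gy //.
- by move=> p q; apply: leq_total.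
- by move=> p q r; apply: leq_trans.
move=> [x' y']; rewrite memL => /and3P[/eqP e Gx' Gy'] h.
exists x', y'; split=> //; apply/minpairP; split => /=.
- by case/andP: Gx'.
- by case/andP: Gy'.
move=> [u v] /= du dv euv; rewrite /chain_lt adeg_Gset //=.
case: (posnP (adeg d (u, v))) => [auv|]; last by right.
have [Gu Gv] : u \in Gset /\ v \in Gset.
  move: auv; rewrite /adeg /= !inE du dv.
  by case: (u == avec n d); case: (v == avec n d).
have /h hle : (u, v) \in L by rewrite memL euv e eqxx Gu Gv.
rewrite auv /= !lexlt_ltmc ?(Gset_mdeg Gx', Gset_mdeg Gy', Gset_mdeg Gu, Gset_mdeg Gv) //.
case: (ltgtP x' u) => [_|lt|exu]; first by right.
  move: hle; rewrite /le /= leqNgt => /negP[].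
  apply: (@code_cat_lt [:: u] [:: x'] [:: v] [:: y']); rewrite //= ?Gv //.
  by rewrite !muln1 !addn0; apply: rho_mono.
by left; subst u; move/addmI: (etrans euv (erefl _)) => ->.
Qed.

Lemma exists_minpair_lt x y : x \in Gset -> y \in Gset -> ~~ minpair x y ->
  exists x' y', [/\ x' \in Gset, y' \in Gset, minpair x' y' &
    (x' + y' = x + y)%MM /\ (x' < x)%O].
Proof.
move=> Gx Gy nm; have [x' [y' [Gx' Gy' m e]]] := exists_minpair Gx Gy.
exists x', y'; split=> //; split=> //; move/minpairP: (m) => [_ _ /(_ (x, y))] /=.
case/andP: (Gx) (Gy) => dx _ /andP[dy _] /(_ dx dy (esym e)).
case=> [[ex ey]|]; first by rewrite -ex -ey m in nm.
rewrite /chain_lt !adeg_Gset //= !lexlt_ltmc ?(Gset_mdeg Gx', Gset_mdeg Gy', Gset_mdeg Gx, Gset_mdeg Gy) //.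
case/orP=> // /andP[/eqP exx lt]; move: e lt; rewrite exx => /addmI ->.
by rewrite ltxx.
Qed.

(** Replacing a nonminimal adjacent pair by the minimal one with the same sum lowers its first
    entry, hence the code, so rewriting terminates. *)
Lemma exists_normal w : Gword w ->
  exists v, [/\ normal v, wsum v = wsum w, size v = size w & code v <= code w].
Proof.
have [m] := ubnP (code w); elim: m w => // m ih w cw Gw.
have [sw|] := boolP (sorted minpair w); first by exists w; rewrite /normal Gw.
case/not_sorted_split => p [x [y [q [ew nm]]]]; subst w.
move: (Gw); rewrite all_cat /= => /and4P[Gp Gx Gy Gq].
have [x' [y' [Gx' Gy' m' [e lt]]]] := exists_minpair_lt Gx Gy nm.
have ltc : code (p ++ [:: x', y' & q]) < code (p ++ [:: x, y & q]).
  rewrite !code_cat /= ltn_add2l; apply: ltn_numeral; last exact: rho_mono.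
  by have := @code_lt (y' :: q); rewrite /= Gq andbT => /(_ Gy').
have [||v [nv ev sv cv]] := ih (p ++ [:: x', y' & q]).
- exact: leq_trans ltc _.
- by rewrite all_cat /= Gp Gx' Gy' Gq.
exists v; split=> //; last exact: leq_trans cv (ltnW ltc).
  by rewrite ev !wsum_cat !wsum_cons !(addmA _ _ (wsum q)) e.
by rewrite sv !size_cat.
Qed.

Hypothesis d_gt0 : 0 < d.
Hypothesis nf_uniq : forall s t, normal s -> normal t -> wsum s = wsum t -> s = t.

Lemma wsum_size s t : Gword s -> Gword t -> wsum s = wsum t -> size s = size t.
Proof.
by move=> Gs Gt /(congr1 mdeg); rewrite !(mdeg_wsum (d := d)) // => /eqP; rewrite eqn_pmul2r // => /eqP.
Qed.

Lemma normal_Gword s : normal s -> Gword s.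
Proof. by case/andP. Qed.

Lemma normal_code_le s t : normal s -> Gword t -> wsum s = wsum t -> code s <= code t.
Proof.
move=> ns Gt e; have [v [nv ev _]] := exists_normal Gt.
by rewrite (nf_uniq ns nv) // e.
Qed.

(** * Antinormal words, the bases of the free modules in the resolution *)

Definition antinormal s := Gword s && sorted (fun x y => ~~ minpair x y) s.

Fixpoint antinormal_words i : seq (seq 'X_{1..n}) :=
  if i is i'.+1 then
    [seq w <- [seq x :: c | x <- Gam n d, c <- antinormal_words i'] | antinormal w]
  else [:: [::]].

Lemma mem_antinormal_words i w :
  (w \in antinormal_words i) = (size w == i) && antinormal w.
Proof.
elim: i w => [|i ih] w; first by case: w.
rewrite /= mem_filter andbC; case: (boolP (antinormal w)) => [aw|]; last by rewrite !andbF.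
rewrite !andbT; apply/allpairsP/eqP => [[[x c] /= [_]]|].
  by rewrite ih => /andP[/eqP <- _] ->.
case: w aw => // x c /andP[/= /andP[Gx Gc] sc] [sz]; exists (x, c).
by rewrite /= mem_Gam ih sz eqxx /antinormal Gc (path_sorted sc).
Qed.

Lemma antinormal_words_uniq i : uniq (antinormal_words i).
Proof.
elim: i => //= i ih; rewrite filter_uniq //; apply: allpairs_uniq => //; first exact: Gam_uniq.
by move=> [x c] [y c'] _ _ /= [-> ->].
Qed.

Definition awd i (k : 'I_(size (antinormal_words i))) : seq 'X_{1..n} :=
  nth [::] (antinormal_words i) k.

Lemma awd_inj i : injective (@awd i).
Proof.
move=> k l /eqP; rewrite nth_uniq ?antinormal_words_uniq // => /eqP; exact: val_inj.
Qed.

Lemma awdP i (k : 'I_(size (antinormal_words i))) :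
  size (awd k) = i /\ antinormal (awd k).
Proof.
have : awd k \in antinormal_words i by apply: mem_nth.
by rewrite mem_antinormal_words => /andP[/eqP].
Qed.

Lemma awd_surj i w : size w = i -> antinormal w -> exists k, @awd i k = w.
Proof.
move=> sz aw; have wi : w \in antinormal_words i by rewrite mem_antinormal_words sz eqxx.
have lt : index w (antinormal_words i) < size (antinormal_words i) by rewrite index_mem.
by exists (Ordinal lt); rewrite /awd nth_index.
Qed.
End Words.
Arguments antinormal_words : simpl never.

Local Open Scope ring_scope.

(** * The resolution over the field *)

Section ScalarResolution.
Variables (K : fieldType) (n d : nat).
Hypothesis d_gt0 : (0 < d)%N.
Hypothesis nf_uniq : forall s t, normal d s -> normal d t -> wsum s = wsum t -> s = t
  :> seq 'X_{1..n}.
Implicit Types (lam : 'X_{1..n}) (N : nat).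
Local Notation b i := (size (antinormal_words n d i)).
Local Notation Gset := (@Gset n d).
Local Notation Gword := (all (mem Gset)).
Local Notation code := (code d).

(* [h] stands for the multidegree-[lam] element of [R^(b i)] whose [k]-th entry is
   the multiple [h 0 k] of the monomial [lam - wsum (awd k)]; the basis element at
   [k] is identified with the word [v ++ awd k], [v] being the normal word of that
   monomial. *)
Definition bounded lam N i (h : 'rV[K]_(b i)) : Prop :=
  forall k, h 0 k != 0 -> exists v, [/\ normal d v,
    lam = (wsum v + wsum (awd k))%MM & (code (v ++ awd k) < N)%N].

(** The basis word [y :: c] is sent to the same word, read as [y] times the basis element [c], plus
    words of smaller code. Every nonzero entry shifts the multidegree by a single letter [z], which
    yields linearity. *)
Definition leading i (D : 'M[K]_(b i.+1, b i)) : Prop :=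
  (forall k k', D k k' != 0 -> exists z, [/\ z \in Gset,
     wsum (awd k) = (z + wsum (awd k'))%MM &
     (code (z :: awd k') <= code (awd k))%N]) /\
  (forall k k', awd k' = behead (awd k) -> D k k' = 1).

Lemma Gword_cons x s : Gword (x :: s) = (x \in Gset) && Gword s.
Proof. by []. Qed.

Lemma Gword_rcons s x : Gword (rcons s x) = (x \in Gset) && Gword s.
Proof. exact: all_rcons. Qed.

Lemma normal1 x : x \in Gset -> normal d [:: x].
Proof. by move=> Gx; rewrite /normal Gword_cons Gx. Qed.

Lemma antinormal_cons2 x y s : antinormal d [:: x, y & s] =
  [&& x \in Gset, ~~ minpair d x y & antinormal d (y :: s)].
Proof.
rewrite /antinormal Gword_cons /=.
by case: (x \in _) => //=; case: (minpair d x y); rewrite //= andbF.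
Qed.

Lemma awd_Gword i (k : 'I_(b i)) : Gword (awd k).
Proof. by have [_ /andP[]] := awdP k. Qed.

Lemma awd_size i (k : 'I_(b i)) : size (awd k) = i.
Proof. by have [] := awdP k. Qed.

(** In a fixed multidegree the words [v ++ awd k] have equal length, and their last [i] letters
    recover [k]. So leading terms are unambiguous. *)
Lemma bounded_word_inj lam i (k k' : 'I_(b i)) v v' : normal d v -> normal d v' ->
  lam = (wsum v + wsum (awd k))%MM -> lam = (wsum v' + wsum (awd k'))%MM ->
  code (v ++ awd k) = code (v' ++ awd k') -> k = k'.
Proof.
move=> /normal_Gword Gv /normal_Gword Gv' -> e /code_inj ec; apply: awd_inj.
have Gw : Gword (v ++ awd k) by rewrite all_cat Gv awd_Gword.
have Gw' : Gword (v' ++ awd k') by rewrite all_cat Gv' awd_Gword.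
have sz : size (v ++ awd k) = size (v' ++ awd k').
  by apply: (wsum_size d_gt0 Gw Gw'); rewrite !wsum_cat.
have /eqP := ec Gw Gw' sz; rewrite eqseq_cat; first by case/andP => _ /eqP.
by move: sz; rewrite !size_cat !awd_size => /addIn.
Qed.

Lemma bounded_leq lam N N' i (h : 'rV[K]_(b i)) :
  (N <= N')%N -> bounded lam N h -> bounded lam N' h.
Proof. by move=> le hb k /hb[v [? ? ?]]; exists v; split=> //; apply: leq_trans le. Qed.

Lemma normal_rcons_prefix v y : normal d (rcons v y) -> normal d v /\ y \in Gset.
Proof.
case/andP; rewrite Gword_rcons => /andP[Gy Gv]; rewrite -cats1 => /cat_sorted2[sv _].
by rewrite /normal Gv sv.
Qed.

(** Division by leading terms, by induction on the bound [N]. The leading word [v ++ awd k] of [g]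
    also reads as [v'] times the basis element [y :: awd k]; subtracting the image of the matching
    multiple of that element lowers the bound. [Z] stands for the cycle condition. *)
Lemma lift_cycles i (E : 'M[K]_(b i.+1, b i)) lam (Z : 'rV[K]_(b i) -> Prop) :
  leading E -> (forall g h, Z g -> Z (g - h *m E)) ->
  (forall g k v, Z g -> g 0 k != 0 -> normal d v ->
     lam = (wsum v + wsum (awd k))%MM -> bounded lam (code (v ++ awd k)).+1 g ->
     exists v' y, v = rcons v' y /\ antinormal d (y :: awd k)) ->
  forall N g, bounded lam N g -> Z g -> exists2 h, bounded lam N h & g = h *m E.
Proof.
move=> [E1 E2] Zsub Zlead; elim=> [|N ih] g gb Zg.
  exists 0; first by move=> k; rewrite mxE eqxx.
  rewrite mul0mx; apply/rowP => k; rewrite [RHS]mxE; apply/eqP/negPn/negP.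
  by case/gb => v [].
case: (excluded_middle_informative (exists k v, [/\ g 0 k != 0, normal d v,
    lam = (wsum v + wsum (awd k))%MM & code (v ++ awd k) = N])); last first.
  move=> none; have [|h hb ->] := ih g _ Zg; last first.
    by exists h => //; apply: bounded_leq hb.
  move=> k gk; have [v [nv ev cv]] := gb k gk; exists v; split=> //.
  rewrite ltn_neqAle -ltnS cv andbT; apply/eqP => e; apply: none; by exists k, v.
move=> [k [v [gk nv ev cv]]].
have [|v' [y [evy an]]] := Zlead g k v Zg gk nv ev; first by rewrite cv.
have [k2 ek2] : exists k2 : 'I_(b i.+1), awd k2 = y :: awd k.
  by apply: awd_surj; rewrite //= awd_size.
have [nv' Gy] : normal d v' /\ y \in Gset by apply: normal_rcons_prefix; rewrite -evy.
pose h0 : 'rV[K]_(b i.+1) := g 0 k *: delta_mx 0 k2.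
have h0b : bounded lam N.+1 h0.
  move=> j; rewrite !mxE eqxx /=; case: (eqVneq j k2) => [->|]; last by rewrite mulr0 eqxx.
  move=> _; exists v'; rewrite ek2 wsum_cons; split=> //.
    by rewrite ev evy wsum_rcons addmA.
  by rewrite -cat_rcons -evy cv.
have h0E j : (h0 *m E) 0 j = g 0 k * E k2 j.
  by rewrite -scalemxAl -rowE !mxE.
have [||h hb eh] := ih (g - h0 *m E); last first.
- exists (h0 + h); last by rewrite mulmxDl -eh addrC subrK.
  move=> j; rewrite mxE; case: (eqVneq (h0 0 j) 0) => [->|h0j _]; last exact: h0b.
  by rewrite add0r; apply: (bounded_leq (leqnSn N)).
- exact: Zsub.
(* The entry at [k] cancels. Elsewhere the code is at most [N], and the value [N] belongs to [k]
   alone. *)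
move=> j; rewrite mxE [X in _ + X]mxE h0E; case: (eqVneq j k) => [->|jk].
  by rewrite E2 ?mulr1 ?subrr ?eqxx // ek2.
move=> nz; have [w [nw ew cw]] : exists w, [/\ normal d w,
    lam = (wsum w + wsum (awd j))%MM & (code (w ++ awd j) < N.+1)%N].
  have [gj|/gb//] := eqVneq (g 0 j) 0.
  have Ekj : E k2 j != 0 by apply: contraNneq nz => ->; rewrite gj mulr0 subr0.
  have [z [Gz ez cz]] := E1 _ _ Ekj.
  have Gw' : Gword (rcons v' z) by rewrite Gword_rcons Gz normal_Gword.
  have [w [nw ew sw cw]] := exists_normal Gw'; exists w; split=> //.
    rewrite ev evy ew !wsum_rcons -!addmA -ez ek2 wsum_cons //.
  rewrite ltnS -cv evy cat_rcons -ek2.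
  apply: leq_trans (_ : code (rcons v' z ++ awd j) <= _)%N; first exact: code_cat_le.
  by rewrite cat_rcons; apply: code_cat_le; rewrite //= !awd_size.
exists w; split=> //; rewrite ltn_neqAle -ltnS cw andbT; apply/eqP => e.
by case/eqP: jk; apply: (bounded_word_inj nw nv ew ev); rewrite e cv.
Qed.

(** Let [awd k] be [y :: c]. If [rcons v y] is not normal, the last letter of [v] forms a nonminimal
    pair with [y], as wanted. If it is normal, it has the least code for its sum, so no other entry
    of [g] can reach [c] in that multidegree, and the coefficient of [g *m D] at [c] is [g 0 k],
    which is nonzero. *)
Lemma kernel_leading i (D : 'M[K]_(b i.+1, b i)) lam (g : 'rV[K]_(b i.+1)) k v :
  leading D -> g *m D = 0 -> g 0 k != 0 -> normal d v ->
  lam = (wsum v + wsum (awd k))%MM -> bounded lam (code (v ++ awd k)).+1 g ->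
  exists v' y, v = rcons v' y /\ antinormal d (y :: awd k).
Proof.
move=> [D1 D2] gD gk nv ev gb.
have := awdP k; case ek: (awd k) => [|y c] [] // [sc] ac.
have ac' : antinormal d c.
  by case/andP: ac => /= /andP[_ Gc] /path_sorted sc'; rewrite /antinormal Gc sc'.
have [k0 ek0] := awd_surj sc ac'.
have Gy : y \in Gset by case/andP: ac => /andP[].
have [nvy|nnvy] := boolP (normal d (rcons v y)); last first.
  case/lastP: v nv nnvy {ev gb} => [_|v x nv nnvy]; first by rewrite normal1.
  have [_ Gx] := normal_rcons_prefix nv.
  exists v, x; split=> //; rewrite antinormal_cons2 Gx ac andbT.
  apply: contra nnvy => m; case/andP: nv => Gvx svx.
  rewrite /normal Gword_rcons Gvx andbT; apply/andP; split=> //.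
  case: v Gvx svx => [|v0 v] Gvx svx; first by rewrite /= m.
  by rewrite /= rcons_path last_rcons m andbT.
suff : (g *m D) 0 k0 = g 0 k by rewrite gD mxE => e; rewrite -e eqxx in gk.
rewrite mxE (bigD1 k) //= D2 ?ek0 ?ek // mulr1 big1 ?addr0 // => j jk.
apply/eqP; rewrite mulf_eq0; apply/negPn/negP; rewrite negb_or => /andP[gj Dj].
have [w [nw ew cw]] := gb j gj; have [z [Gz ez cz]] := D1 _ _ Dj.
have wz : wsum (rcons v y) = wsum (rcons w z).
  apply: (@addIm _ (wsum c)); rewrite !wsum_rcons -!addmA -[in RHS]ek0 -ez -ew ev ek.
  by rewrite wsum_cons.
have Gwz : Gword (rcons w z) by rewrite Gword_rcons Gz normal_Gword.
have le1 := normal_code_le nf_uniq nvy Gwz wz.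
case/eqP: jk; apply: (bounded_word_inj nw nv ew ev); apply/eqP.
rewrite eqn_leq -ltnS cw /= ek -cat_rcons.
apply: leq_trans (code_cat_le (erefl _) le1 (leqnn _)) _.
by rewrite cat_rcons -ek0; apply: code_cat_le; rewrite //= !awd_size.
Qed.

Lemma exact_bounded i (D : 'M[K]_(b i.+1, b i)) (E : 'M[K]_(b i.+2, b i.+1)) :
  leading D -> leading E -> E *m D = 0 -> forall lam N g,
  bounded lam N g -> g *m D = 0 -> exists2 h, bounded lam N h & g = h *m E.
Proof.
move=> LD LE ED lam N g; apply: (lift_cycles (Z := fun g => g *m D = 0)) => //.
  by move=> g' h e; rewrite mulmxBl e -mulmxA ED mulmx0 subr0.
by move=> g' k v; apply: kernel_leading.
Qed.

Lemma exact_bounded0 (E : 'M[K]_(b 1, b 0)) : leading E -> forall lam N g,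
  bounded lam N g -> lam != 0%MM -> exists2 h, bounded lam N h & g = h *m E.
Proof.
move=> LE lam N g gb l0; apply: (lift_cycles (Z := fun _ => True)) => //.
move=> g' k v _ _ nv ev _; have ek : awd k = [::] by apply/nilP; rewrite /nilp awd_size.
rewrite ek; case/lastP: v nv ev => [_|v y nv _].
  by rewrite ek wsum_nil addm0 => e; rewrite e eqxx in l0.
by exists v, y; split=> //; have [_ Gy] := normal_rcons_prefix nv; rewrite /antinormal Gword_cons Gy.
Qed.

(** Lifting is stated for elements of the image of [D], so that it also covers the first matrix,
    which has no differential before its target. *)
Definition liftable i (D : 'M[K]_(b i.+1, b i)) : Prop := leading D /\
  forall lam N u, lam != 0%MM -> bounded lam N (u *m D) ->
    exists2 h, bounded lam N h & u *m D = h *m D.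

(** For the word [[:: y, x & c]], start from [y] times the basis element [x :: c]. Since (y, x) is
    not minimal, normalizing makes its image under [D] strictly smaller; a lift [h] of the image
    with this smaller bound is subtracted to obtain a cycle. *)
Lemma next_row i (D : 'M[K]_(b i.+1, b i)) (k : 'I_(b i.+2)) : liftable D ->
  exists r : 'rV[K]_(b i.+1), [/\ r *m D = 0,
    (forall k', r 0 k' != 0 -> exists z, [/\ z \in Gset,
       wsum (awd k) = (z + wsum (awd k'))%MM &
       (code (z :: awd k') <= code (awd k))%N]) &
    forall k', awd k' = behead (awd k) -> r 0 k' = 1].
Proof.
case=> -[D1 D2] Dlift; have := awdP k; case ek: (awd k) => [|y [|x c]] [] // [sc] ac.
have Gyxc : Gword [:: y, x & c] by case/andP: ac.
have /= /and3P[Gy Gx Gc] := Gyxc.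
have nm : ~~ minpair d y x by move: ac; rewrite antinormal_cons2 => /and3P[].
have ac' : antinormal d (x :: c).
  by move: ac; rewrite antinormal_cons2 => /and3P[].
have [k0 ek0] : exists k0 : 'I_(b i.+1), awd k0 = x :: c.
  by apply: awd_surj; rewrite //= sc.
have l0 : wsum [:: y, x & c] != 0%MM.
  by rewrite -mdeg_eq0 (mdeg_wsum Gyxc) muln_eq0 negb_or -!lt0n d_gt0.
(* The image consists of terms [z] times [c']. If [z :: c'] is smaller than [x :: c], prefixing [y]
   keeps it smaller; if they are equal, the pair (y, x) itself gets a smaller normal word. *)
have rb : bounded (wsum [:: y, x & c]) (code [:: y, x & c]) (delta_mx 0 k0 *m D).
  move=> j; rewrite -rowE mxE => /D1[z [Gz ez cz]].
  have Gyz : Gword [:: y; z] by rewrite !Gword_cons Gy Gz.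
  have [v [nv ev sv cv]] := exists_normal Gyz; exists v; split=> //.
    by rewrite ev wsum_cons -ek0 ez !wsum_cons wsum_nil addm0 addmA.
  move: cz; rewrite leq_eqVlt ek0 => /predU1P[cz|cz].
    have [ezx ej] : z = x /\ awd j = c.
      have : z :: awd j = x :: c; last by case.
      apply: code_inj cz; rewrite /= ?awd_size ?sc // ?Gx //.
      by rewrite awd_Gword andbT.
    rewrite ej -[[:: y, x & c]]/([:: y; x] ++ c); apply: code_cat_lt => //.
    rewrite -ezx ltn_neqAle cv andbT; apply/eqP => /code_inj e.
    have {}e := e (normal_Gword nv) Gyz sv.
    by move: nv; rewrite e ezx /normal /= (negPf nm) !andbF.
  apply: leq_ltn_trans (_ : code ([:: y; z] ++ awd j) < _)%N; first exact: code_cat_le.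
  by move: cz; rewrite /= awd_size sc ltn_add2l.
have [h hb eh] := Dlift _ _ _ l0 rb.
(* At [k0] the coefficient could only be the normal word [[:: y]], whose code equals the strict
   bound. *)
have hk0 : h 0 k0 = 0.
  apply/eqP/negPn/negP => /hb[v [nv ev cv]].
  have {}ev : wsum v = wsum [:: y].
    apply: (@addIm _ (wsum (awd k0))); rewrite -ev ek0.
    by rewrite !wsum_cons wsum_nil addm0.
  have ny : normal d [:: y] by exact: normal1.
  by rewrite (nf_uniq nv ny ev) ek0 ltnn in cv.
exists (delta_mx 0 k0 - h); split.
- by rewrite mulmxBl -eh subrr.
- move=> k'; rewrite !mxE eqxx /=; case: (eqVneq k' k0) => [->|_].
    by move=> _; exists y; rewrite ek0 wsum_cons.
  rewrite sub0r oppr_eq0 => /hb[v [nv ev cv]].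
  (* Comparing the lengths of two words with the same sum leaves exactly one letter for [v]. *)
  have Gv : Gword (v ++ awd k') by rewrite all_cat normal_Gword // awd_Gword.
  have := wsum_size d_gt0 Gyxc Gv; rewrite wsum_cat => /(_ ev).
  rewrite size_cat awd_size /= sc -[in LHS](add1n i.+1) => /addIn sv.
  case: v sv nv ev cv {Gv} => [|z [|? ?]] // _ nv ev cv; exists z; split.
  + by case/andP: nv => /andP[].
  + by rewrite ev wsum_cons wsum_nil addm0.
  + by have := ltnW cv; rewrite /= awd_size sc.
- move=> k'; rewrite /= -ek0 => /awd_inj ->.
  by rewrite !mxE !eqxx hk0 subr0.
Qed.

Lemma next_matrix i (D : 'M[K]_(b i.+1, b i)) : liftable D ->
  exists2 E : 'M[K]_(b i.+2, b i.+1), liftable E & E *m D = 0.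
Proof.
move=> LD; have [f fP] := fin_all_exists (fun k => next_row k LD).
pose E : 'M[K]_(b i.+2, b i.+1) := \matrix_(k, k') f k 0 k'.
have ED : E *m D = 0.
  apply/row_matrixP => k; rewrite row_mul row0; have [<- _ _] := fP k.
  by congr (_ *m _); apply/rowP => k'; rewrite !mxE.
have LE : leading E.
  by split=> k k'; rewrite mxE; have [_ h1 h2] := fP k; [apply: h1|apply: h2].
exists E => //; split=> // lam N u _ ub.
by apply: (exact_bounded (proj1 LD) LE ED ub); rewrite -mulmxA ED mulmx0.
Qed.

(** Each one-letter word maps to the empty word; after homogenization this is the column of
    generators of the maximal ideal. *)
Lemma first_matrix : liftable (const_mx 1 : 'M[K]_(b 1, b 0)).
Proof.
have LD : leading (const_mx 1 : 'M[K]_(b 1, b 0)).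
  split=> k k'; rewrite mxE // => _.
  have -> : awd k' = [::] by apply/nilP; rewrite /nilp awd_size.
  have := awd_Gword k; have := awd_size k; case: (awd k) => [|z [|? ?]] //= _.
  by rewrite andbT => Gz; exists z; rewrite wsum_cons.
by split=> // lam N u l0 ub; apply: exact_bounded0.
Qed.

(** Indefinite description turns existence into the data on which [resolution] recurses. *)
Lemma next_matrix_sig i (D : 'M[K]_(b i.+1, b i)) : liftable D ->
  {E : 'M[K]_(b i.+2, b i.+1) | liftable E & E *m D = 0}.
Proof.
move=> LD; have ex : exists E : 'M[K]_(b i.+2, b i.+1), liftable E /\ E *m D = 0.
  by have [E LE ED] := next_matrix LD; exists E.
by have [E [LE ED]] := constructive_indefinite_description _ ex; exists E.
Qed.

Fixpoint resolution i : {D : 'M[K]_(b i.+1, b i) | liftable D} :=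
  if i is i'.+1 then
    let E := next_matrix_sig (svalP (resolution i')) in exist _ (s2val E) (s2valP E)
  else exist _ _ first_matrix.

Lemma resolution_exists : exists D : forall i, 'M[K]_(b i.+1, b i),
  [/\ forall i, leading (D i), forall i, D i.+1 *m D i = 0,
      forall lam N g, bounded lam N g -> lam != 0%MM ->
        exists2 h, bounded lam N h & g = h *m D 0%N &
      forall i lam N g, bounded lam N g -> g *m D i = 0 ->
        exists2 h, bounded lam N h & g = h *m D i.+1].
Proof.
pose D i := sval (resolution i).
have LD i : leading (D i) by have [] := svalP (resolution i).
have DD i : D i.+1 *m D i = 0 by exact: s2valP' (next_matrix_sig _).
exists D; split=> //; first exact: exact_bounded0.
by move=> i lam N g; apply: exact_bounded.
Qed.

End ScalarResolution.

(** * The resolution over the semigroup ring *)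

Lemma mcoeffMX_sub (R : nzRingType) n (p : {mpoly R[n]}) (m k : 'X_{1..n}) :
  (p * 'X_[m])@_k = if (m <= k)%MM then p@_(k - m) else 0.
Proof.
case: ifPn => [/submK mk|nmk]; first by rewrite -[in LHS]mk addmC mcoeffMX.
apply/eqP; rewrite mcoeff_eq0; apply: contra nmk.
by rewrite (perm_mem (msuppMX _ _)) => /mapP[k' _ ->]; apply: lem_addr.
Qed.

Section SemigroupRing.
Variables (K : fieldType) (n d : nat).
Local Notation Gset := (@Gset n d).
Local Notation Gword := (all (mem Gset)).
Local Notation g := (gsz n d).
Implicit Types (u : 'X_{1..g}) (F : {mpoly K[g]}).

Lemma galpha_Gset (i : 'I_g) : galpha i \in Gset.
Proof. by rewrite -mem_Gam mem_nth. Qed.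

Lemma galpha_surj x : x \in Gset -> exists i : 'I_g, galpha i = x.
Proof.
rewrite -mem_Gam => Gx; have lt : (index x (Gam n d) < g)%N by rewrite index_mem.
by exists (Ordinal lt); rewrite /galpha nth_index.
Qed.

Lemma galpha_inj : injective (@galpha n d).
Proof. by move=> i j /eqP; rewrite nth_uniq ?Gam_uniq // => /eqP/val_inj. Qed.

(** A monomial of S as a word, its letters in the order of [Gam]; it has to be sorted before
    normality is tested. *)
Definition mword u : seq 'X_{1..n} := flatten [seq nseq (u i) (galpha i) | i <- enum 'I_g].

Lemma mword_Gword u : Gword (mword u).
Proof.
apply/allP => x /flattenP[s /mapP[i _ ->]].
by rewrite mem_nseq => /andP[_ /eqP ->]; apply: galpha_Gset.
Qed.

Lemma wsum_mword u : wsum (mword u) = (\sum_(i < g) galpha i *+ u i)%MM.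
Proof.
rewrite /wsum big_flatten big_map big_enum; apply: eq_bigr => i _.
by rewrite big_nseq -Monoid.iteropE; elim: (u i) => //= k ->; rewrite mulmS.
Qed.

Lemma phiG_X u : phiG 'X_[u] = 'X_[wsum (mword u)] :> {mpoly K[n]}.
Proof.
rewrite /phiG comp_mpolyX wsum_mword -mprodXnE.
by apply: eq_bigr => i _; rewrite tnth_mktuple.
Qed.

Lemma phiG_U (i : 'I_g) : phiG 'X_i = 'X_[galpha i] :> {mpoly K[n]}.
Proof. by rewrite /phiG /comp_mpoly mmapX mmap1U tnth_mktuple. Qed.

Lemma phiGE F : phiG F = \sum_(u <- msupp F) F@_u *: 'X_[wsum (mword u)].
Proof.
rewrite {1}(mpolyE F) /phiG raddf_sum /=; apply: eq_bigr => u _.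
by rewrite linearZ /= -phiG_X.
Qed.

Lemma inKG0 : inKG d (0 : {mpoly K[n]}).
Proof. by exists 0; rewrite /phiG raddf0. Qed.

Lemma inKGD p q : inKG d p -> inKG d q -> inKG d (p + q : {mpoly K[n]}).
Proof. by move=> [P <-] [Q <-]; exists (P + Q); rewrite /phiG raddfD. Qed.

Lemma inKGZ a p : inKG d p -> inKG d (a *: p : {mpoly K[n]}).
Proof. by move=> [P <-]; exists (a *: P); rewrite /phiG linearZ. Qed.

Lemma inKG_wsum w : Gword w -> inKG d ('X_[wsum w] : {mpoly K[n]}).
Proof.
elim: w => [_|x w ih /= /andP[/galpha_surj[i <-] /ih[P eP]]].
  by exists 1; rewrite wsum_nil mpolyX0 /phiG rmorph1.
exists ('X_i * P); rewrite wsum_cons mpolyXD -eP -phiG_U.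
by rewrite /phiG rmorphM.
Qed.

Lemma inKG_supp p m : inKG d (p : {mpoly K[n]}) -> p@_m != 0 ->
  exists2 w, Gword w & wsum w = m.
Proof.
move=> [F <-]; rewrite phiGE -mcoeff_msupp => /msupp_sum_le.
case/flattenP => s /mapP[u _ ->] /msuppZ_le; rewrite msuppX inE => /eqP ->.
by exists (mword u); first exact: mword_Gword.
Qed.

End SemigroupRing.

(** * Homogenization: from scalar matrices to linear forms *)

Section LinearResolution.
Variables (K : fieldType) (n d : nat).
Hypothesis d_gt0 : (0 < d)%N.
Hypothesis nf_uniq : forall s t, normal d s -> normal d t -> wsum s = wsum t -> s = t
  :> seq 'X_{1..n}.
Implicit Types (lam m : 'X_{1..n}) (N : nat).
Local Notation b i := (size (antinormal_words n d i)).
Local Notation Gset := (@Gset n d).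
Local Notation Gword := (all (mem Gset)).
Local Notation P := {mpoly K[n]}.

Definition adegr i (k : 'I_(b i)) : 'X_{1..n} := wsum (awd k).

(** For a [leading] matrix the difference of multidegrees is a genuine one wherever [D r c] is
    nonzero. *)
Definition polymx i (D : 'M[K]_(b i.+1, b i)) : 'M[P]_(b i.+1, b i) :=
  \matrix_(r, c) (D r c *: 'X_[adegr r - adegr c]).

(** The guard excludes truncated differences, which would pick coefficients from other
    multidegrees. *)
Definition component lam i (v : 'rV[P]_(b i)) : 'rV[K]_(b i) :=
  \row_c (if (adegr c <= lam)%MM then (v 0 c)@_(lam - adegr c) else 0).

Definition monomial_row lam i (h : 'rV[K]_(b i)) : 'rV[P]_(b i) :=
  \row_c (h 0 c *: 'X_[lam - adegr c]).

Lemma leading_adegr i (D : 'M[K]_(b i.+1, b i)) r c : leading D -> D r c != 0 ->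
  exists2 z, z \in Gset & adegr r = (z + adegr c)%MM.
Proof. by move=> [h _] /h[z [Gz e _]]; exists z. Qed.

Lemma component_mul lam i (D : 'M[K]_(b i.+1, b i)) v : leading D ->
  component lam (v *m polymx D) = component lam v *m D.
Proof.
move=> LD; apply/rowP => s; rewrite !mxE.
have [ls|nls] := boolP (adegr s <= lam)%MM; last first.
  apply/esym/big1 => c _; rewrite !mxE; have [->|Dcs] := eqVneq (D c s) 0; first by rewrite mulr0.
  have [z _ e] := leading_adegr LD Dcs.
  rewrite ifN ?mul0r //; apply: contra nls; rewrite e; apply: lepm_trans.
  exact: lem_addl.
rewrite raddf_sum /=; apply: eq_bigr => c _; rewrite !mxE.
have [->|Dcs] := eqVneq (D c s) 0; first by rewrite scale0r !mulr0 raddf0.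
have [z _ e] := leading_adegr LD Dcs.
rewrite e addmK -scalerAr mcoeffZ mulrC mcoeffMX_sub; congr (_ * _).
have -> : (z <= lam - adegr s)%MM = (z + adegr s <= lam)%MM.
  apply/mnm_lepP/mnm_lepP => h k; move: (h k); rewrite !mnmE;
  by move/mnm_lepP/(_ k): ls; lia.
by case: ifP => // _; congr mcoeff; apply/mnmP => k; rewrite !mnmE; lia.
Qed.

Lemma monomial_row_mul lam N i (E : 'M[K]_(b i.+1, b i)) h : leading E ->
  bounded lam N h -> monomial_row lam h *m polymx E = monomial_row lam (h *m E).
Proof.
move=> LE hb; apply/rowP => c; rewrite !mxE scaler_suml; apply: eq_bigr => r _.
rewrite !mxE; have [->|hr] := eqVneq (h 0 r) 0; first by rewrite scale0r !mul0r scale0r.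
have [->|Erc] := eqVneq (E r c) 0; first by rewrite scale0r !mulr0 scale0r.
have [z _ e] := leading_adegr LE Erc; have [v [_ el _]] := hb r hr.
rewrite -scalerAl -scalerAr scalerA -mpolyXD; congr (_ *: 'X_[_]).
by apply/mnmP => k; rewrite el -/(adegr r) e !mnmE; lia.
Qed.

Lemma component_sum i (v : 'rV[P]_(b i)) :
  exists L, v = \sum_(lam <- L) monomial_row lam (component lam v).
Proof.
pose L := undup [seq (m + adegr c)%MM | c <- enum 'I_(b i), m <- msupp (v 0 c)].
exists L; apply/rowP => c; rewrite summxE; apply/mpolyP => m; rewrite raddf_sum /=.
pose lam0 := (m + adegr c)%MM.
have term lam : lam != lam0 -> (monomial_row lam (component lam v) 0 c)@_m = 0.
  move=> ll; rewrite !mxE mcoeffZ mcoeffX; case: ifP => [le|_]; last by rewrite mul0r.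
  case: eqP => [e|_]; last by rewrite mulr0.
  by case/eqP: ll; rewrite /lam0 -e submK.
have term0 : (monomial_row lam0 (component lam0 v) 0 c)@_m = (v 0 c)@_m.
  by rewrite !mxE lem_addl addmK mcoeffZ mcoeffX eqxx mulr1.
have [lL|lL] := boolP (lam0 \in L).
  by rewrite (bigD1_seq lam0) ?undup_uniq //= term0 big1 ?addr0 // => lam; apply: term.
rewrite big1_seq; last by move=> lam /= lamL; apply: term; apply: contraNneq lL => <-.
apply/eqP; rewrite mcoeff_eq0; apply: contra lL => mc; rewrite mem_undup.
by apply/allpairsPdep; exists c, m; rewrite mem_enum.
Qed.

Lemma rowKG_bounded lam i (v : 'rV[P]_(b i)) : rowKG d v ->
  exists N, bounded lam N (component lam v).
Proof.
(* A word of sum [lam] has at most [mdeg lam] letters because d > 0; the successor makes the base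
   positive, so that the power grows with the exponent. *)
move=> vKG; exists ((gsz n d).+1 ^ mdeg lam)%N => k; rewrite mxE.
case: ifP => [le nz|]; last by rewrite eqxx.
have [w Gw ew] := inKG_supp (vKG k) nz; have [v' [nv' ev' _ _]] := exists_normal Gw.
have el : lam = (wsum v' + wsum (awd k))%MM by rewrite ev' ew submK.
exists v'; split=> //.
have Gvk : Gword (v' ++ awd k) by rewrite all_cat normal_Gword // awd_Gword.
apply: leq_trans (code_lt Gvk) _; rewrite el -wsum_cat (mdeg_wsum Gvk).
apply: (@leq_trans ((gsz n d).+1 ^ size (v' ++ awd k))%N).
  by case: (size _) => // q; rewrite leq_exp2r.
by rewrite leq_pexp2l // leq_pmulr.
Qed.

Lemma bounded_rowKG lam N i (h : 'rV[K]_(b i)) :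
  bounded lam N h -> rowKG d (monomial_row lam h).
Proof.
move=> hb c; rewrite mxE; have [->|/hb[v [nv -> _]]] := eqVneq (h 0 c) 0.
  by rewrite scale0r; apply: inKG0.
by rewrite addmK; apply/inKGZ/inKG_wsum/normal_Gword.
Qed.

(** A row is the finite sum of its multigraded components, and each component is lifted over the
    field. *)
Lemma rowKG_lift i (E : 'M[K]_(b i.+1, b i)) (v : 'rV[P]_(b i)) : leading E ->
  rowKG d v ->
  (forall lam N, bounded lam N (component lam v) ->
     exists2 h, bounded lam N h & component lam v = h *m E) ->
  exists w : 'rV[P]_(b i.+1), rowKG d w /\ v = w *m polymx E.
Proof.
move=> LE vKG lift; have [L {1}->] := component_sum v.
apply: (big_ind (fun x => exists w : 'rV[P]_(b i.+1), rowKG d w /\ x = w *m polymx E)).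
- by exists 0; rewrite mul0mx; split=> // c; rewrite mxE; apply: inKG0.
- move=> x y [w [wKG ->]] [w' [wKG' ->]]; exists (w + w'); rewrite mulmxDl; split=> // c.
  by rewrite mxE; apply: inKGD.
move=> lam _; have [N vb] := rowKG_bounded lam vKG; have [h hb ->] := lift lam N vb.
exists (monomial_row lam h); rewrite (monomial_row_mul LE hb); split=> //.
exact: bounded_rowKG hb.
Qed.

Lemma polymx_linear i (D : 'M[K]_(b i.+1, b i)) r c : leading D -> linKG d (polymx D r c).
Proof.
move=> LD; rewrite mxE; have [->|Drc] := eqVneq (D r c) 0.
  by exists 0; rewrite msupp0 /phiG raddf0 scale0r.
have [z /galpha_surj[j <-] ->] := leading_adegr LD Drc; exists (D r c *: 'X_j); split.
  by apply/allP => u /msuppZ_le; rewrite msuppX inE => /eqP ->; rewrite mdeg1.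
by rewrite addmK /phiG linearZ /= -phiG_U.
Qed.

Lemma polymx_comp i (D : 'M[K]_(b i.+1, b i)) (E : 'M[K]_(b i.+2, b i.+1)) :
  leading D -> leading E -> E *m D = 0 -> polymx E *m polymx D = 0.
Proof.
move=> LD LE ED; apply/matrixP => r c; rewrite !mxE.
transitivity ((E *m D) r c *: 'X_[adegr r - adegr c] : P); last by rewrite ED mxE scale0r.
rewrite mxE scaler_suml; apply: eq_bigr => s _; rewrite !mxE.
have [->|Ers] := eqVneq (E r s) 0; first by rewrite scale0r !mul0r scale0r.
have [->|Dsc] := eqVneq (D s c) 0; first by rewrite scale0r !mulr0 scale0r.
have [z _ e] := leading_adegr LE Ers; have [z' _ e'] := leading_adegr LD Dsc.
rewrite -scalerAl -scalerAr scalerA -mpolyXD; congr (_ *: 'X_[_]).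
by apply/mnmP => k; rewrite e e' !mnmE; lia.
Qed.

Lemma koszul_of_normal_uniq : koszulKG K n d.
Proof.
have [D [LD DD ex0 ex]] := resolution_exists K d_gt0 nf_uniq.
(* [koszulKG] starts at the map onto the maximal ideal, hence the shift; words of length 0 give the
   single column of the first matrix. *)
exists (fun i => b i.+1), (polymx (D 0%N)), (fun i => polymx (D i.+1)).
have exact i : exactKG d (polymx (D i.+1)) (polymx (D i)).
  move=> v vKG; split=> [vD|[w [_ ->]]]; last by rewrite -mulmxA polymx_comp // mulmx0.
  apply: rowKG_lift => // lam N vb; apply: ex => //.
  rewrite -component_mul // vD; apply/rowP => c; rewrite !mxE raddf0.
  by case: ifP.
split=> //.
- by move=> r c; apply: polymx_linear.
- by move=> i r c; apply: polymx_linear.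
move=> f fKG; split=> [f0|[w [_ ->]]].
  have [|lam N vb|w [wKG e]] := @rowKG_lift 0 (D 0%N) (const_mx f) (LD 0%N).
  - by move=> c; rewrite mxE.
  (* In multidegree 0 the component is the constant term of [f], which vanishes. *)
  - have [l0|] := eqVneq lam 0%MM; last exact: ex0.
    exists 0; first by move=> k; rewrite mxE eqxx.
    rewrite mul0mx; apply/rowP => c; rewrite l0 !mxE; case: ifP => // _.
    by rewrite (_ : (0 - _)%MM = 0%MM) //; apply/mnmP => k; rewrite !mnmE sub0n.
  - by exists w; split=> //; rewrite -e mxE.
(* Conversely, the entries of the first matrix are scalar multiples of t^z with z of degree d > 0,
   so no product has a constant term. *)
rewrite mxE raddf_sum /= big1 // => r _; rewrite mxE.
have [->|nz] := eqVneq (D 0%N r ord0) 0; first by rewrite scale0r mulr0 raddf0.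
have [z Gz ->] := leading_adegr (LD 0%N) nz.
rewrite addmK -scalerAr mcoeffZ mcoeffMX_sub ifN ?mulr0 //.
apply/negP => /mnm_lepP z0; have := Gset_mdeg Gz; rewrite mdegE big1; first lia.
by move=> k _; have := z0 k; rewrite mnm0E; lia.
Qed.

End LinearResolution.

(** * The Groebner basis *)

Section Grevlex.
Variables n d : nat.
Local Notation g := (gsz n d).
Local Notation glt := (@grevlex_lt n d).
Local Notation alpha := (@galpha n d).
Implicit Types (i j k l : 'I_g) (u v w : 'X_{1..g}).

Lemma galpha_mdeg i : mdeg (alpha i) = d.
Proof. exact/Gset_mdeg/galpha_Gset. Qed.

Lemma grevlexP u v : reflect ((mdeg u < mdeg v)%N \/ mdeg u = mdeg v /\
  exists2 i, (v i < u i)%N & forall j, (alpha i < alpha j)%O -> u j = v j) (glt u v).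
Proof.
apply: (iffP orP) => -[lt|].
- by left.
- case/andP => /eqP e /existsP[i /andP[lt /forallP h]]; right; split=> //.
  by exists i => // j; rewrite -lexlt_ltmc ?galpha_mdeg // => /(implyP (h j))/eqP.
- by left.
- case=> e [i lt h]; right; rewrite e eqxx; apply/existsP; exists i; rewrite lt.
  by apply/forallP => j; apply/implyP; rewrite lexlt_ltmc ?galpha_mdeg // => /h /eqP.
Qed.

Lemma grevlex_irr u : glt u u = false.
Proof. by apply/grevlexP => -[|[_ [i]]]; rewrite ltnn. Qed.

Lemma grevlex_trans : transitive glt.
Proof.
move=> v u w /grevlexP[uv|[uv [i iuv huv]]] /grevlexP[vw|[vw [j jvw hvw]]]; apply/grevlexP.
- by left; apply: ltn_trans vw.
- by left; rewrite -vw.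
- by left; rewrite uv.
right; split; first by rewrite uv.
case: (ltgtP (alpha i) (alpha j)) => [lt|lt|/galpha_inj e].
- exists j; first by rewrite huv.
  by move=> k jk; rewrite huv ?hvw //; apply: lt_trans jk.
- exists i; first by rewrite -hvw.
  by move=> k ik; rewrite huv ?hvw //; apply: lt_trans ik.
- exists i; first by apply: ltn_trans iuv; rewrite e.
  by move=> k ik; rewrite huv ?hvw // -e.
Qed.

Lemma grevlex_total u v : u != v -> glt u v || glt v u.
Proof.
move=> uv; case: (ltngtP (mdeg u) (mdeg v)) => e; try by rewrite /grevlex_lt e ?orbT.
have [i0 ui0] : exists i, u i != v i.
  apply/existsP; apply: contraNT uv; rewrite negb_exists => /forallP h.
  by apply/eqP/mnmP => i; apply/eqP/negPn.
(* The reversed relation picks the lexicographically largest [alpha i] where the exponents differ,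
   that is, the smallest such variable. *)
have [] := @seq_minimum _ [rel i j | (alpha j <= alpha i)%O] [seq i <- enum 'I_g | u i != v i] i0.
- by move=> i j; apply: le_total.
- by move=> j i k /= ij jk; apply: le_trans jk ij.
- by rewrite mem_filter ui0 mem_enum.
move=> i; rewrite mem_filter => /andP[ui _] h.
have {}h j : (alpha i < alpha j)%O -> u j = v j.
  move=> lt; apply/eqP/negPn/negP => uj; have := h j; rewrite mem_filter uj mem_enum.
  by move=> /(_ isT) /=; rewrite leNgt lt.
case: (ltngtP (u i) (v i)) ui => // lt _; apply/orP; [right|left]; apply/grevlexP; right.
  by split=> //; exists i => // j /h.
by split=> //; exists i.
Qed.

Definition gle : rel 'X_{1..g} := [rel u v | (u == v) || glt u v].

Lemma gle_total : total gle.
Proof.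
by move=> u v; rewrite /gle /=; have [->|/grevlex_total/orP[]->] := eqVneq u v; rewrite ?eqxx ?orbT.
Qed.

Lemma gle_trans : transitive gle.
Proof.
move=> v u w /predU1P[->//|uv] /predU1P[<-|vw]; rewrite /gle /=; first by rewrite uv orbT.
by rewrite (grevlex_trans uv vw) orbT.
Qed.

Lemma grevlex_add2l w u v : glt u v -> glt (w + u)%MM (w + v)%MM.
Proof.
move=> /grevlexP h; apply/grevlexP; rewrite !mdegD; case: h => [lt|[-> [i lt h]]].
  by left; rewrite ltn_add2l.
right; split=> //; exists i; first by rewrite !mnmDE ltn_add2l.
by move=> j /h e; rewrite !mnmDE e.
Qed.

(** Equal sums and alpha_k < alpha_i force alpha_l > alpha_j. So x_l is the smallest of the four
    variables and is absent from x_i x_j, which decides the comparison. *)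
Lemma grevlex_pair i j k l : (alpha k + alpha l = alpha i + alpha j)%MM ->
  (alpha k < alpha i)%O -> (alpha i <= alpha j)%O ->
  glt (U_(k) + U_(l))%MM (U_(i) + U_(j))%MM.
Proof.
move=> e ki ij; have jl : (alpha j < alpha l)%O.
  rewrite ltNge; apply/negP => lj; have := ltmc_le_add ki lj.
  by rewrite e ltxx.
apply/grevlexP; right; rewrite !mdegD !mdeg1; split=> //.
have neq i' l' : (alpha i' < alpha l')%O -> (i' == l') = false.
  by move=> lt; apply/eqP => e'; rewrite e' ltxx in lt.
have il := le_lt_trans ij jl; have kl := lt_trans ki il.
exists l; first by rewrite !mnmDE !mnm1E (neq i l) // (neq j l) // (neq k l) // eqxx.
move=> m lm; rewrite !mnmDE !mnm1E (neq l m) //.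
by rewrite (neq i m) ?(neq j m) ?(neq k m) ?(lt_trans jl) ?(lt_trans il) ?(lt_trans kl).
Qed.

Lemma count_mword i u : count_mem (alpha i) (mword u) = u i.
Proof.
rewrite /mword count_flatten sumnE -map_comp big_map big_enum /= (bigD1 i) //= count_nseq /= eqxx.
rewrite mul1n big1 ?addn0 // => j ji; rewrite count_nseq /=.
by rewrite (inj_eq (@galpha_inj n d)) (negPf ji).
Qed.

Lemma mword_inj u v : perm_eq (mword u) (mword v) -> u = v.
Proof. by move=> /permP h; apply/mnmP => i; rewrite -!count_mword h. Qed.

Lemma wsum_mwordD u v : wsum (mword (u + v)%MM) = (wsum (mword u) + wsum (mword v))%MM.
Proof.
rewrite !wsum_mword -big_split /=; apply: eq_bigr => i _.
by apply/mnmP => k; rewrite !(mnmDE, mulmnE) mulnDr.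
Qed.

Lemma wsum_mwordU i : wsum (mword U_(i)%MM) = alpha i.
Proof.
rewrite wsum_mword (bigD1 i) //= mnm1E eqxx mulm1n big1 ?addm0 // => j ji.
by rewrite mnm1E eq_sym (negPf ji) mulm0n.
Qed.

Lemma not_normal_pair u : ~~ normal d (sort <=%O (mword u)) -> exists i j,
  [/\ (alpha i <= alpha j)%O, ~~ minpair d (alpha i) (alpha j) & (U_(i) + U_(j) <= u)%MM].
Proof.
rewrite /normal all_sort mword_Gword /= => /not_sorted_split[p [x [y [q [e nm]]]]].
have Gs : all (mem (@Gset n d)) (sort <=%O (mword u)) by rewrite all_sort mword_Gword.
have sle : sorted <=%O (sort <=%O (mword u)) by apply: sort_le_sorted.
have cnt i : count_mem (alpha i) (sort <=%O (mword u)) = u i.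
  by rewrite count_sort count_mword.
rewrite e in Gs sle cnt; move: Gs; rewrite all_cat /= => /and4P[_ Gx Gy _].
have [i ei] := galpha_surj Gx; have [j ej] := galpha_surj Gy.
exists i, j; rewrite ei ej; split=> //.
  by move: sle => /cat_sorted2[_ /= /andP[]].
apply/mnm_lepP => k; rewrite mnmDE !mnm1E -cnt count_cat /= -ei -ej.
by rewrite !(inj_eq (@galpha_inj n d)); lia.
Qed.

End Grevlex.

(** * Normal monomials and leading terms *)

Section Groebner.
Variables (K : fieldType) (n d : nat).
Hypothesis nf_uniq : forall s t, normal d s -> normal d t -> wsum s = wsum t -> s = t
  :> seq 'X_{1..n}.
Local Notation g := (gsz n d).
Local Notation glt := (@grevlex_lt n d).
Local Notation alpha := (@galpha n d).
Implicit Types (i j k l : 'I_g) (u v w : 'X_{1..g}).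

Lemma binomG_inIG (F : {mpoly K[g]}) : binomG F -> inIG F.
Proof.
move=> [i [j [k [l [_ _ _ e ->]]]]].
by rewrite /inIG /phiG rmorphB !rmorphM /= -!/(phiG _) !phiG_U -!mpolyXD e subrr.
Qed.

Lemma grevlex_lead_exists (f : {mpoly K[g]}) : f != 0 -> exists u, is_lead_mon glt f u.
Proof.
rewrite -msupp_eq0 => nz.
have [u0 fu0] : exists u, u \in msupp f.
  by case: (msupp f) nz => // u s _; exists u; rewrite mem_head.
have [] := @seq_minimum _ [rel u v | gle v u] (msupp f) u0 _ _ fu0.
- by move=> u v; apply: gle_total.
- by move=> v u w /= vu wv; apply: gle_trans wv vu.
by move=> u fu h; exists u; split=> // v /h /predU1P[->|//]; rewrite eqxx.
Qed.

Lemma reduce_pair i j : (alpha i <= alpha j)%O -> ~~ minpair d (alpha i) (alpha j) ->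
  exists k l, [/\ minpair d (alpha k) (alpha l),
    (alpha k + alpha l = alpha i + alpha j)%MM & glt (U_(k) + U_(l))%MM (U_(i) + U_(j))%MM].
Proof.
move=> ij nm.
have [x [y [/galpha_surj[k <-] /galpha_surj[l <-] m [e lt]]]] :=
  exists_minpair_lt (galpha_Gset i) (galpha_Gset j) nm.
by exists k, l; split=> //; apply: grevlex_pair.
Qed.

(** Among the finitely many monomials with the same image and degree at most [mdeg u], the smallest
    admits no reduction, so its sorted word is normal; by uniqueness it is [u]. *)
Lemma normal_grevlex_min u v : normal d (sort <=%O (mword u)) ->
  wsum (mword v) = wsum (mword u) -> ~~ glt v u.
Proof.
move=> nu evu; apply/negP => vu.
pose L := [seq val x | x <- enum {: 'X_{1..g < (mdeg u).+1}} &
            wsum (mword (val x)) == wsum (mword u)].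
have memL w : (w \in L) = (mdeg w <= mdeg u)%N && (wsum (mword w) == wsum (mword u)).
  apply/mapP/andP => [[x]|[dw ew]].
    by rewrite mem_filter => /andP[ew _] ->; split=> //; rewrite -ltnS bmdeg.
  by exists (BMultinom (dw : mdeg w < (mdeg u).+1)%N); rewrite // mem_filter ew mem_enum.
have le_deg w w' : glt w w' -> (mdeg w <= mdeg w')%N.
  by move/grevlexP => [/ltnW//|[-> _]].
have vL : v \in L by rewrite memL evu eqxx le_deg.
have [m mL mmin] := seq_minimum (@gle_total n d) (@gle_trans n d) vL.
have /andP[dm /eqP em] : (mdeg m <= mdeg u)%N && (wsum (mword m) == wsum (mword u)).
  by rewrite -memL.
have nm : normal d (sort <=%O (mword m)).
  apply/negPn/negP => /not_normal_pair[i [j [ij nmin le]]].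
  have [k [l [_ e lt]]] := reduce_pair ij nmin.
  have lt' := grevlex_add2l (m - (U_(i) + U_(j)))%MM lt.
  rewrite (submK le) in lt'; set m' := (_ + (U_(k) + U_(l)))%MM in lt'.
  have m'L : m' \in L.
    rewrite memL (leq_trans (le_deg _ _ lt') dm) /=; apply/eqP.
    by rewrite -em -[in RHS](submK le) !wsum_mwordD !wsum_mwordU e.
  have /predU1P[emm|mm'] := mmin m' m'L; first by rewrite -emm grevlex_irr in lt'.
  by have := grevlex_trans lt' mm'; rewrite grevlex_irr.
have emu : m = u.
  apply: mword_inj; rewrite -(perm_sort <=%O) perm_sym -(perm_sort <=%O).
  rewrite (@nf_uniq (sort <=%O (mword u)) (sort <=%O (mword m))) //.
  by rewrite !(perm_wsum (permEl (perm_sort _ _))).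
have /predU1P[emv|] := mmin v vL; first by rewrite -emv emu grevlex_irr in vu.
by rewrite emu => /(grevlex_trans vu); rewrite grevlex_irr.
Qed.

(** A leading monomial of an element of the ideal is not normal, so it is divisible by some x_i x_j
    with (alpha_i, alpha_j) nonminimal, the leading monomial of a binomial in the set. *)
Lemma groebner_of_normal_uniq :
  groebner_basis (@grevlex_lt n d) (@inIG K n d) (@binomG K n d).
Proof.
split; first exact: binomG_inIG.
move=> f fI fn0; have [u uf] := grevlex_lead_exists fn0.
have [nu|] := boolP (normal d (sort <=%O (mword u))).
  case: (uf) => fu ulead.
  (* If [u] were normal, no smaller monomial would share its image, so its coefficient would survive
     in [phiG f]. *)
  have : (phiG f)@_(wsum (mword u)) = 0 by rewrite fI mcoeff0.
  rewrite phiGE raddf_sum /= (bigD1_seq u) //= mcoeffZ mcoeffX eqxx mulr1.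
  rewrite big1_seq ?addr0; first by move/eqP; rewrite mcoeff_eq0 fu.
  move=> v /andP[vu fv]; rewrite mcoeffZ mcoeffX; case: eqP => [e|_]; last by rewrite mulr0.
  by have := normal_grevlex_min nu e; rewrite ulead.
case/not_normal_pair => i [j [ij nm le]]; have [k [l [m e lt]]] := reduce_pair ij nm.
pose G : {mpoly K[g]} := 'X_[U_(i) + U_(j)] - 'X_[U_(k) + U_(l)].
have neq : (U_(k) + U_(l) == U_(i) + U_(j))%MM = false.
  by apply/eqP => e'; rewrite e' grevlex_irr in lt.
have ijG : (U_(i) + U_(j))%MM \in msupp G.
  by rewrite mcoeff_msupp mcoeffB !mcoeffX eqxx neq subr0 oner_eq0.
exists G; split.
- exists i, j, k, l; rewrite lexle_lemc ?galpha_mdeg //; split=> //.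
  + by move/minpairP; rewrite (negPf nm).
  + exact/minpairP.
  + by rewrite /G !mpolyXD.
- by apply: contraTneq ijG => ->; rewrite msupp0.
exists u, (U_(i) + U_(j))%MM; split=> //; split=> // v /msuppB_le.
by rewrite !msuppX !inE => /orP[/eqP ->|/eqP ->]; rewrite ?eqxx.
Qed.

End Groebner.

Theorem theorem2p7 (K : fieldType) (n d : nat) :
  (2 <= n)%N -> (2 <= d)%N -> d <> 3%N ->
  groebner_basis (@grevlex_lt n d) (@inIG K n d) (@binomG K n d) /\
  koszulKG K n d.
Proof.
move=> n_gt1 d_gt1 d_neq3.
have ltM : (n.-2 < n)%N by lia.
have ltN : (n.-1 < n)%N by lia.
have nf_uniq := @normal_uniq n d (Ordinal ltM) (Ordinal ltN) n_gt1 d_gt1 erefl erefl d_neq3.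
split; first exact: groebner_of_normal_uniq.
by apply: koszul_of_normal_uniq => //; apply: ltnW.
Qed.
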